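(* Consider the finite-sum bilevel problem, with $f=\frac1n\sum_{i=1}^nF_i$ and $g=\frac1m\sum_{j=1}^mG_j$. Fix a number of iterations $K>1$ and assume: (i) $\nabla f$ is $L^f$-Lipschitz in $(x,y)$, and there is $C^f>0$ with $\|\nabla_2 f(x,y^*(x))\|\le C^f$ for all $x$; (ii) $\nabla g$ and $\nabla^2 g$ are $L_1^g$- and $L_2^g$-Lipschitz in $(x,y)$, respectively, and $g(x,\cdot)$ is $\mu$-strongly convex for every $x$; (iii) the stochastic (here: component) maps $\nabla F_i$, $\nabla G_j$, $\nabla^2G_j$ are respectively $L^f$-, $L_1^g$-, $L_2^g$-Lipschitz in $(x,y)$. Then there exist positive constants $c$, $c_\beta$ and $c_\gamma$ such that if $$\alpha_k\le\frac{c}{1+\sqrt{\frac{1-p}{pb}}},\qquad \beta_k=c_\beta\alpha_k,\qquad\gamma_k=c_\gamma\alpha_k,$$ then the iterates of SPABA (finite-sum version, with minibatch size $b$ and probability $p$) satisfy $$\frac1K\sum_{k=0}^{K-1}\mathbb E\left[\|\nabla H(x_k)\|^2\right]=\mathcal O\left(\frac{1+\sqrt{\frac{1-p}{pb}}}{K}\right).$$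
   Context: Bilevel problem: minimize $H(x)=f(x,y^*(x))$ over $x\in\mathbb{R}^{d_x}$, where $y^*(x)=\arg\min_{y\in\mathbb{R}^{d_y}}g(x,y)$ and $f,g$ are smooth real-valued functions on $\mathbb{R}^{d_x}\times\mathbb{R}^{d_y}$. $\nabla_1,\nabla_2$ are the partial gradients in $x$ and $y$; $\nabla_{12}^2$ ($d_x\times d_y$) and $\nabla_{22}^2$ ($d_y\times d_y$) are blocks of the Hessian. Put $$D_x(x,y,z)=\nabla_1f(x,y)-\nabla_{12}^2g(x,y)z,\quad D_y(x,y,z)=\nabla_2g(x,y),\quad D_z(x,y,z)=\nabla_{22}^2g(x,y)z-\nabla_2f(x,y).$$ Let $R=C^f/\mu$ and let $\mathrm{Proj}_{\mathbb B(R)}$ be the Euclidean projection onto the ball of radius $R$ centered at $0$ in $\mathbb R^{d_y}$. SPABA (finite-sum version). The inputs are initial directions $(v_{-1}^x,v_{-1}^y,v_{-1}^z)$, initial points $(x_{-1},y_{-1},z_{-1})$ and $(x_0,y_0,z_0)$, the number of iterations $K$, step sizes $\alpha_k,\beta_k,\gamma_k$, the minibatch size $b$, the probability $p\in(0,1]$ and the constant $R$. At iteration $k$, sample minibatches $I\subset[n]$ (for $f$) and $J\subset[m]$ (for $g$) with $|I|=|J|=b$. Write $u_k=(x_k,y_k,z_k)$, and for $\bullet\in\{x,y,z\}$ let $\widehat D_\bullet(u;I,J)$ be the minibatch version of $D_\bullet(u)$ obtained by replacing $f$ by $\frac1b\sum_{i\in I}F_i$ and $g$ by $\frac1b\sum_{j\in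 J}G_j$. For each $\bullet\in\{x,y,z\}$, $$v_k^\bullet=\begin{cases}D_\bullet(u_k)&\text{with probability }p,\\ v_{k-1}^\bullet+\widehat D_\bullet(u_k;I,J)-\widehat D_\bullet(u_{k-1};I,J)&\text{with probability }1-p.\end{cases}$$ Updates: $x_{k+1}=x_k-\alpha_kv_k^x$, $y_{k+1}=y_k-\beta_kv_k^y$, $z_{k+1}=\mathrm{Proj}_{\mathbb B(R)}(z_k-\gamma_kv_k^z)$.
   Formalization: The formal statement adds that H is bounded below and that α_k is at least a fixed fraction θ>0 of c/(1+√((1-p)/(pb))); the O-constant depends on θ and on a bound B for the initial gap and the initial errors. Without the two additions the claim is false. *)

(* Defs.v *)
From HB Require Import structures.
From mathcomp Require Import all_boot all_order all_algebra.
From mathcomp Require Import all_classical all_reals all_analysis.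

Set Implicit Arguments.
Unset Strict Implicit.
Unset Printing Implicit Defensive.

Import Order.TTheory GRing.Theory Num.Theory.
Import numFieldNormedType.Exports.

Local Open Scope classical_set_scope.
Local Open Scope ring_scope.

Section Euclidean.
Context {R : realType}.

(* The library norm `|v| of a matrix is the max norm, hence this definition. *)
Definition enorm {d : nat} (v : 'cV[R]_d) : R :=
  Num.sqrt (\sum_(i < d) v i 0 ^+ 2).

(* Operator norm induced by the Euclidean norms. *)
Definition opnorm {d e : nat} (A : 'M[R]_(d, e)) : R :=
  sup [set enorm (A *m v) | v in [set v : 'cV[R]_e | enorm v <= 1]].

(* Some minimizer of phi over A; an arbitrary vector if there is none. *)
Definition argmin_on {d : nat} (A : set 'cV[R]_d) (phi : 'cV[R]_d -> R)
    : 'cV[R]_d :=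
  get [set y | A y /\ forall y', A y' -> phi y <= phi y'].

Definition proj_ball {d : nat} (r : R) (z : 'cV[R]_d) : 'cV[R]_d :=
  argmin_on [set w | enorm w <= r] (fun w => enorm (w - z)).

Definition grad {d : nat} (phi : 'cV[R]_d -> R) (u : 'cV[R]_d) : 'cV[R]_d :=
  \col_(i < d) 'D_(delta_mx i 0) phi u.

Definition hess {d : nat} (phi : 'cV[R]_d -> R) (u : 'cV[R]_d) : 'M[R]_d :=
  \matrix_(i < d, j < d) 'D_(delta_mx j 0) (fun u' => grad phi u' i 0) u.

Definition lipschitz_grad {d : nat} (L : R) (phi : 'cV[R]_d -> R) : Prop :=
  (forall u, differentiable phi u) /\
  forall u u', enorm (grad phi u - grad phi u') <= L * enorm (u - u').

Definition lipschitz_hess {d : nat} (L : R) (phi : 'cV[R]_d -> R) : Prop :=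
  [/\ forall u, differentiable phi u,
      forall u, differentiable (grad phi) u &
      forall u u', opnorm (hess phi u - hess phi u') <= L * enorm (u - u')].

Definition strongly_convex {d : nat} (mu : R) (phi : 'cV[R]_d -> R) : Prop :=
  forall (y y' : 'cV[R]_d) (t : R), 0 <= t <= 1 ->
    phi (t *: y + (1 - t) *: y') <=
      t * phi y + (1 - t) * phi y'
      - mu / 2 * t * (1 - t) * enorm (y - y') ^+ 2.

End Euclidean.

(* A function of (x, y) is a function of the stacked vector col_mx x y, so that
   partial gradients and Hessian blocks are submatrices of grad and hess. *)
Section Bilevel.
Context {R : realType} {dx dy : nat}.
Implicit Types f g : 'cV[R]_(dx + dy) -> R.

Definition ystar g (x : 'cV[R]_dx) : 'cV[R]_dy :=
  argmin_on setT (fun y => g (col_mx x y)).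

Definition hyper f g (x : 'cV[R]_dx) : R := f (col_mx x (ystar g x)).

(* Triples (x, y, z); also used for triples of directions (v^x, v^y, v^z). *)
Definition point : Type := ('cV[R]_dx * 'cV[R]_dy * 'cV[R]_dy)%type.

Definition psub (w w' : point) : point :=
  (w.1.1 - w'.1.1, w.1.2 - w'.1.2, w.2 - w'.2).

Definition padd (w w' : point) : point :=
  (w.1.1 + w'.1.1, w.1.2 + w'.1.2, w.2 + w'.2).

Definition psqnorm (w : point) : R :=
  enorm w.1.1 ^+ 2 + enorm w.1.2 ^+ 2 + enorm w.2 ^+ 2.

Definition D f g (w : point) : point :=
  let: (x, y, z) := w in
  let u := col_mx x y in
  (usubmx (grad f u) - ursubmx (hess g u) *m z,
   dsubmx (grad g u),
   drsubmx (hess g u) *m z - dsubmx (grad f u)).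

End Bilevel.

Arguments point : clear implicits.

Definition mean {R : realType} {N n : nat} (F : 'I_n -> 'cV[R]_N -> R)
    (u : 'cV[R]_N) : R :=
  n%:R^-1 * \sum_(i < n) F i u.

Definition batch_mean {R : realType} {N n : nat} (b : nat)
    (F : 'I_n -> 'cV[R]_N -> R) (S : {set 'I_n}) (u : 'cV[R]_N) : R :=
  b%:R^-1 * \sum_(i in S) F i u.

Section Spaba.
Context {R : realType} {dx dy n m : nat}.
Variables (F : 'I_n -> 'cV[R]_(dx + dy) -> R) (G : 'I_m -> 'cV[R]_(dx + dy) -> R).
Variables (b : nat) (r : R) (alpha beta gamma : nat -> R).

(* The randomness of one iteration: for each of x, y, z a coin telling whether
   the full direction is used, and the minibatches for F and G. *)
Definition coins : Type := (bool * bool * bool)%type.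
Definition sample : Type := (coins * {set 'I_n} * {set 'I_m})%type.

(* At iteration k: u_(k-1), u_k and v_(k-1). *)
Record state := State {
  prev : point R dx dy;
  cur : point R dx dy;
  dir : point R dx dy }.

Definition new_dir (st : state) (s : sample) : point R dx dy :=
  let: (c, SI, SJ) := s in
  let full := D (mean F) (mean G) (cur st) in
  let Dhat := D (batch_mean b F SI) (batch_mean b G SJ) in
  let vr := padd (dir st) (psub (Dhat (cur st)) (Dhat (prev st))) in
  (if c.1.1 then full.1.1 else vr.1.1,
   if c.1.2 then full.1.2 else vr.1.2,
   if c.2 then full.2 else vr.2).

Definition step (k : nat) (st : state) (s : sample) : state :=
  let v := new_dir st s in
  let: (x, y, z) := cur st in
  State (cur st)
        (x - alpha k *: v.1.1,
         y - beta k *: v.1.2,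
         proj_ball r (z - gamma k *: v.2))
        v.

Fixpoint run (st0 : state) (w : nat -> sample) (k : nat) : state :=
  if k is k'.+1 then step k' (run st0 w k') (w k') else st0.

Definition xiter (st0 : state) (w : nat -> sample) (k : nat) : 'cV[R]_dx :=
  (cur (run st0 w k)).1.1.

End Spaba.

Section Expectation.
Context {R : realType} {n m : nat}.

(* Each coin shows "full" with probability p. The joint law is otherwise free:
   one shared coin and three independent coins are both instances. *)
Definition coin_law (p : R) (q : coins -> R) : Prop :=
  (forall c, 0 <= q c) /\
  [/\ \sum_(c : coins) q c = 1,
      \sum_(c : coins | c.1.1) q c = p,
      \sum_(c : coins | c.1.2) q c = p &
      \sum_(c : coins | c.2) q c = p].

(* Uniform law on the subsets of size b of 'I_N. *)
Definition unif_batch {N : nat} (b : nat) (S : {set 'I_N}) : R :=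
  if #|S| == b then ('C(N, b)%:R)^-1 else 0.

Definition sample_prob (b : nat) (q : coins -> R) (s : @sample n m) : R :=
  q s.1.1 * unif_batch b s.1.2 * unif_batch b s.2.

(* Expectation of X, a function of the samples of iterations 0, ..., K-1, which
   are independent with law sample_prob. The default value of nth stands for
   the samples of the iterations >= K, on which x_0, ..., x_(K-1) do not
   depend. *)
Definition run_mean (K b : nat) (q : coins -> R)
    (X : (nat -> @sample n m) -> R) : R :=
  \sum_(w : K.-tuple (@sample n m))
    (\prod_(k < K) sample_prob b q (tnth w k)) *
    X (nth ((false, false, false), finset.set0, finset.set0) w).

End Expectation.

Definition rate {R : realType} (p : R) (b : nat) : R :=
  1 + Num.sqrt ((1 - p) / (p * b%:R)).

Section Initialization.
Context {R : realType} {dx dy : nat}.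
Variables (f g : 'cV[R]_(dx + dy) -> R) (r : R) (st0 : @state R dx dy).

(* The initial suboptimality (which requires hyper f g to be bounded below) and
   the initial distances of y and z are at most B. *)
Definition initial_gap (B : R) : Prop :=
  let: (x0, y0, z0) := cur st0 in
  [/\ forall x, hyper f g x0 - hyper f g x <= B,
      enorm (y0 - ystar g x0) <= B &
      enorm z0 <= B].

(* With probability 1 - p an iteration keeps the errors of the previous
   direction, so the errors of the initial data survive (1 - p) / p iterations
   on average. This is 0 when p = 1, and also when u_(-1) = u_0,
   v_(-1) = D(u_(-1)) and |z_0| <= r. *)
Definition initial_error (p : R) (b : nat) : R :=
  (1 - p) / p *
  (psqnorm (psub (dir st0) (D f g (prev st0))) +
   (psqnorm (psub (cur st0) (prev st0))
    + enorm ((cur st0).2 - proj_ball r (cur st0).2) ^+ 2) / b%:R).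

End Initialization.

(* Main.v *)
Require Import Defs.
From HB Require Import structures.
From mathcomp Require Import all_boot all_order all_algebra.
From mathcomp Require Import fingroup perm.
From mathcomp Require Import all_classical all_reals all_analysis.
From mathcomp Require Import ring lra.

Set Implicit Arguments.
Unset Strict Implicit.
Unset Printing Implicit Defensive.

Import Order.TTheory GRing.Theory Num.Theory.
Import numFieldNormedType.Exports.

Local Open Scope ring_scope.

(** SPABA follows three coupled quantities: [x_k] descends the hyper-objective
    [H], while [y_k] and [z_k] track the moving targets [ystar x_k], the minimizer
    of the lower level, and [zstar x_k], the solution of the linear system that
    occurs in the gradient of [H].  With [z = zstar x] and [y = ystar x], the
    direction [D_x] is exactly that gradient.

    The smoothness of [H] is obtained without an implicit function theorem
    ([hyper_taylor]): the optimality condition [grad2 g = 0], expanded between [x]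
    and [x + h] and paired with [zstar x], eliminates the unknown increment of
    [ystar] up to [O(|h|^2)].  This needs the symmetry of the Hessian of [g]
    ([hess_sym]) and the Lipschitz continuity of [ystar], a consequence of strong
    convexity.  The same expansion gives the gradient ([grad_hyper]) and the
    descent inequality for [H].

    Along every run, one iteration decreases the potential
    [H(x) + |y - ystar x|^2 + |z - zstar x|^2] by a constant times
    [a_k (|grad H|^2 + |y - ystar x|^2 + |z - zstar x|^2)], up to [a_k] times the
    squared error [S] of the direction that was used ([potential_step]).  The
    moves of [y] and [z] are contractions with rate proportional to the step
    ([tracking_step]), since [D_y] and [D_z] are strongly monotone fields around
    their targets; the drift of the targets is of order [a_k^2], and is dominated
    by the contraction when the ratios [beta / alpha] and [gamma / alpha] are
    large.  The ratio for [y] is chosen after the one for [z] because the error in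
    [y] enters the field followed by [z].

    Randomness enters only through [S].  A direction is recomputed with
    probability [p], and is otherwise corrected by a difference of two minibatch
    directions on the same batch, whose deviation from its mean has variance of
    order [1/b] times the squared displacement of the iterates
    ([mean_sqr_batch_dev]).  Hence ([direction_error_step])
      [E S_(k+1) <= (1 - p) (E S_k + C/b E |u_k - u_(k-1)|^2)],
    so that the errors sum to [(1 - p) / p] times the initial error plus
    [(1 - p) / (p b)] times the squared displacements ([sum_damped_errors]).  A
    displacement is [a_k] times a direction, whose squared norm is controlled by
    [|grad H|^2], the tracking errors and [S].  As [a_k <= c / rate p b] and
    [(1 - p) / (p b) <= (rate p b)^2], the total feedback has coefficient [c^2] and
    is absorbed when [c] is small ([close_feedback]).  What remains is a bound on
    [sum_k a_k E |grad H(x_k)|^2] by a constant, and the lower bound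
    [a_k >= theta c / rate p b] turns it into the rate.

    The field [D_z] is Lipschitz only on bounded sets of [z].  One bounded endpoint
    suffices for a difference of two points ([hess_lip_sqr]); from the first
    iteration on the projection provides it, and for the initial data the constant
    depends on [B] but multiplies only the initial error. *)

Ltac vring := apply/matrixP => ? ?; rewrite !mxE; ring.

(** The limit [t -> 0] of a family of inequalities; it replaces the computation
    of derivatives of explicit one-variable functions. *)
Lemma le_of_le_addM {R : realType} (a b C : R) :
  (forall t, 0 < t <= 1 -> a <= b + t * C) -> a <= b.
Proof.
move=> h; rewrite leNgt; apply/negP => ba.
have C0 : 0 < C by have := h 1; rewrite ltr01 lexx => /(_ isT); lra.
have D0 : 0 < a - b by rewrite subr_gt0.
(* With this t the increment t * C is less than a - b. *)
pose t := (a - b) / (a - b + C).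
have E : t * (a - b + C) = a - b by rewrite divfK // gt_eqF // addr_gt0.
have t0 : 0 < t by rewrite divr_gt0 // addr_gt0.
have t1 : t <= 1 by rewrite /t ler_pdivrMr; lra.
have := h t; rewrite t0 t1 => /(_ isT).
have : 0 < t * (a - b) by rewrite mulr_gt0.
lra.
Qed.

(** * Euclidean geometry of column vectors *)

Section EuclideanSpace.
Context {R : realType}.

Definition dot {d : nat} (u v : 'cV[R]_d) : R := \sum_(i < d) u i 0 * v i 0.

Lemma dotC d (u v : 'cV[R]_d) : dot u v = dot v u.
Proof. by apply: eq_bigr => i _; rewrite mulrC. Qed.

Lemma dotDl d (u u' v : 'cV[R]_d) : dot (u + u') v = dot u v + dot u' v.
Proof. by rewrite -big_split; apply: eq_bigr => i _; rewrite mxE mulrDl. Qed.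

Lemma dotZl d a (u v : 'cV[R]_d) : dot (a *: u) v = a * dot u v.
Proof. by rewrite mulr_sumr; apply: eq_bigr => i _; rewrite mxE mulrA. Qed.

Lemma dotNl d (u v : 'cV[R]_d) : dot (- u) v = - dot u v.
Proof. by rewrite -scaleN1r dotZl mulN1r. Qed.

Lemma dotBl d (u u' v : 'cV[R]_d) : dot (u - u') v = dot u v - dot u' v.
Proof. by rewrite dotDl dotNl. Qed.

Lemma dotDr d (u v v' : 'cV[R]_d) : dot u (v + v') = dot u v + dot u v'.
Proof. by rewrite ![dot u _]dotC dotDl. Qed.

Lemma dotZr d a (u v : 'cV[R]_d) : dot u (a *: v) = a * dot u v.
Proof. by rewrite ![dot u _]dotC dotZl. Qed.

Lemma dotNr d (u v : 'cV[R]_d) : dot u (- v) = - dot u v.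
Proof. by rewrite ![dot u _]dotC dotNl. Qed.

Lemma dotBr d (u v v' : 'cV[R]_d) : dot u (v - v') = dot u v - dot u v'.
Proof. by rewrite dotDr dotNr. Qed.

Lemma dot0l d (v : 'cV[R]_d) : dot 0 v = 0.
Proof. by rewrite -(scale0r 0) dotZl mul0r. Qed.

Lemma dot0r d (v : 'cV[R]_d) : dot v 0 = 0.
Proof. by rewrite dotC dot0l. Qed.

Lemma dot_mulmx d e (A : 'M[R]_(d, e)) (u : 'cV[R]_d) (v : 'cV[R]_e) :
  dot u (A *m v) = dot (A^T *m u) v.
Proof.
rewrite /dot.
under eq_bigr => i _ do rewrite mxE mulr_sumr.
rewrite exchange_big; apply: eq_bigr => j _.
rewrite mxE mulr_suml; apply: eq_bigr => i _.
by rewrite mxE; ring.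
Qed.

Lemma dot_delta d (u : 'cV[R]_d) i : dot u (delta_mx i 0) = u i 0.
Proof.
rewrite /dot (bigD1 i) //= mxE !eqxx mulr1 big1 ?addr0 // => j ji.
by rewrite mxE (negbTE ji) mulr0.
Qed.

Lemma dot_col_mx d e (u u' : 'cV[R]_d) (v v' : 'cV[R]_e) :
  dot (col_mx u v) (col_mx u' v') = dot u u' + dot v v'.
Proof.
rewrite /dot big_split_ord; congr (_ + _); apply: eq_bigr => i _.
  by rewrite !col_mxEu.
by rewrite !col_mxEd.
Qed.

Lemma dotvv_ge0 d (u : 'cV[R]_d) : 0 <= dot u u.
Proof. by apply: sumr_ge0 => i _; rewrite -expr2 sqr_ge0. Qed.

Lemma enorm_ge0 d (u : 'cV[R]_d) : 0 <= enorm u.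
Proof. exact: sqrtr_ge0. Qed.

Lemma sqr_enorm d (u : 'cV[R]_d) : enorm u ^+ 2 = dot u u.
Proof.
by rewrite sqr_sqrtr ?sumr_ge0 // => i _; rewrite sqr_ge0.
Qed.

Lemma sqr_enormE d (u : 'cV[R]_d) : enorm u ^+ 2 = \sum_(i < d) u i 0 ^+ 2.
Proof. by rewrite sqr_enorm. Qed.

Lemma enorm_le d (u : 'cV[R]_d) a : 0 <= a -> (enorm u <= a) = (dot u u <= a ^+ 2).
Proof. by move=> a0; rewrite -sqr_enorm ler_pXn2r ?nnegrE ?enorm_ge0. Qed.

Lemma enorm_mono d e (u : 'cV[R]_d) (v : 'cV[R]_e) :
  (enorm u <= enorm v) = (dot u u <= dot v v).
Proof. by rewrite enorm_le ?enorm_ge0 // sqr_enorm. Qed.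

Lemma enormZ d a (u : 'cV[R]_d) : enorm (a *: u) = `|a| * enorm u.
Proof.
apply/eqP; rewrite -(@eqrXn2 _ 2%N) ?mulr_ge0 ?enorm_ge0 //; apply/eqP.
by rewrite exprMn !sqr_enorm dotZl dotZr real_normK ?num_real // mulrA -expr2.
Qed.

Lemma enormN d (u : 'cV[R]_d) : enorm (- u) = enorm u.
Proof. by rewrite -scaleN1r enormZ normrN1 mul1r. Qed.

Lemma enormB d (u v : 'cV[R]_d) : enorm (u - v) = enorm (v - u).
Proof. by rewrite -enormN opprB. Qed.

Lemma enorm0 d : enorm (0 : 'cV[R]_d) = 0.
Proof. by rewrite -(scale0r 0) enormZ normr0 mul0r. Qed.

Lemma enorm_eq0 d (u : 'cV[R]_d) : enorm u = 0 -> u = 0.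
Proof.
move=> u0; have : dot u u = 0 by rewrite -sqr_enorm u0 expr0n.
move/eqP; rewrite psumr_eq0 => [/allP h|i _]; last by rewrite -expr2 sqr_ge0.
apply/matrixP => i j; rewrite ord1 mxE.
by have := h i (mem_index_enum _); rewrite mulf_eq0 orbb => /eqP.
Qed.

(** Discriminant argument: the square of the norm of [|v|^2 u - <u,v> v] is
    nonnegative. *)
Lemma Cauchy_Schwarz d (u v : 'cV[R]_d) : `|dot u v| <= enorm u * enorm v.
Proof.
have [v0|v0] := eqVneq (enorm v) 0.
  by rewrite (enorm_eq0 v0) dot0r normr0 mulr_ge0 ?enorm_ge0.
rewrite -(@ler_pXn2r _ 2%N) ?nnegrE ?mulr_ge0 ?enorm_ge0 //.
rewrite real_normK ?num_real // exprMn !sqr_enorm.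
have := dotvv_ge0 (dot v v *: u - dot u v *: v).
rewrite !(dotBl, dotBr, dotZl, dotZr) [dot v u]dotC.
set uu := dot u u; set uv := dot u v; set vv := dot v v => h.
have vv0 : 0 < vv by rewrite /vv -sqr_enorm exprn_gt0 // lt_def v0 enorm_ge0.
have : 0 <= vv * (uu * vv - uv ^+ 2).
  by apply: le_trans h _; rewrite le_eqVlt; apply/orP; left; apply/eqP; ring.
by rewrite pmulr_rge0 // subr_ge0.
Qed.

Lemma dot_le_enorm d (u v : 'cV[R]_d) : dot u v <= enorm u * enorm v.
Proof. exact: le_trans (ler_norm _) (Cauchy_Schwarz u v). Qed.

Lemma ler_enormD d (u v : 'cV[R]_d) : enorm (u + v) <= enorm u + enorm v.
Proof.
rewrite enorm_le ?addr_ge0 ?enorm_ge0 // sqrrD !sqr_enorm !(dotDl, dotDr).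
by rewrite [dot v u]dotC; have := dot_le_enorm u v; lra.
Qed.

Lemma ler_enormB d (u v : 'cV[R]_d) : enorm (u - v) <= enorm u + enorm v.
Proof. by rewrite -(enormN v) ler_enormD. Qed.

(** This turns mean value estimates, which hold for scalar functions only, into
    estimates of vectors. *)
Lemma enorm_le_dot d (u : 'cV[R]_d) a : 0 <= a ->
  (forall v, dot u v <= a * enorm v) -> enorm u <= a.
Proof.
move=> a0 /(_ u); rewrite -sqr_enorm expr2.
have [u0|u0] := eqVneq (enorm u) 0; first by rewrite u0.
by rewrite ler_pM2r // lt_def u0 enorm_ge0.
Qed.

(** Young's inequality, with the weight [t] used to balance contraction against
    perturbation. *)
Lemma sqr_enormD_Young d (u v : 'cV[R]_d) t : 0 < t ->
  enorm (u + v) ^+ 2 <=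
    (1 + t) * enorm u ^+ 2 + (1 + t^-1) * enorm v ^+ 2.
Proof.
move=> t0; have := dotvv_ge0 (t *: u - v).
rewrite !sqr_enorm !(dotBl, dotBr, dotDl, dotDr, dotZl, dotZr) [dot v u]dotC.
set uu := dot u u; set uv := dot u v; set vv := dot v v => h.
have : 0 <= t^-1 * (t * (t * uu) - t * uv - (t * uv - vv)).
  by rewrite mulr_ge0 // invr_ge0 ltW.
suff -> : t^-1 * (t * (t * uu) - t * uv - (t * uv - vv)) =
          t * uu - uv *+ 2 + t^-1 * vv by lra.
by field; rewrite gt_eqF.
Qed.

Lemma sqr_enormD2 d (u v : 'cV[R]_d) :
  enorm (u + v) ^+ 2 <= 2 * enorm u ^+ 2 + 2 * enorm v ^+ 2.
Proof. by have := sqr_enormD_Young u v ltr01; rewrite invr1. Qed.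

Lemma sqr_enorm_col_mx d e (u : 'cV[R]_d) (v : 'cV[R]_e) :
  enorm (col_mx u v) ^+ 2 = enorm u ^+ 2 + enorm v ^+ 2.
Proof. by rewrite !sqr_enorm dot_col_mx. Qed.

Lemma enorm_col_mx0 d e (u : 'cV[R]_d) :
  enorm (col_mx u (0 : 'cV[R]_e)) = enorm u.
Proof.
apply/eqP; rewrite -(@eqrXn2 _ 2%N) ?enorm_ge0 //.
by rewrite sqr_enorm_col_mx enorm0 expr0n addr0.
Qed.

Lemma enorm_col_0mx d e (u : 'cV[R]_e) :
  enorm (col_mx (0 : 'cV[R]_d) u) = enorm u.
Proof.
apply/eqP; rewrite -(@eqrXn2 _ 2%N) ?enorm_ge0 //.
by rewrite sqr_enorm_col_mx enorm0 expr0n add0r.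
Qed.

Lemma enorm_usubmx d e (u : 'cV[R]_(d + e)) : enorm (usubmx u) <= enorm u.
Proof.
rewrite -{2}(vsubmxK u) -(@ler_pXn2r _ 2%N) ?nnegrE ?enorm_ge0 //.
by rewrite sqr_enorm_col_mx lerDl sqr_ge0.
Qed.

Lemma enorm_dsubmx d e (u : 'cV[R]_(d + e)) : enorm (dsubmx u) <= enorm u.
Proof.
rewrite -{2}(vsubmxK u) -(@ler_pXn2r _ 2%N) ?nnegrE ?enorm_ge0 //.
by rewrite sqr_enorm_col_mx lerDr sqr_ge0.
Qed.

Lemma enorm_delta d (i : 'I_d) : enorm (delta_mx i 0 : 'cV[R]_d) = 1.
Proof.
apply/eqP; rewrite -(@eqrXn2 _ 2%N) ?enorm_ge0 // sqr_enorm dot_delta.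
by rewrite mxE !eqxx expr1n.
Qed.

(** The supremum defining [opnorm] is finite because each coordinate of
    [A *m v] is at most the norm of a row of [A]. *)
Lemma enorm_mulmx d e (A : 'M[R]_(d, e)) (v : 'cV[R]_e) :
  enorm (A *m v) <= opnorm A * enorm v.
Proof.
set S := [set enorm (A *m v) | v in [set v : 'cV[R]_e | enorm v <= 1]]%classic.
have bS : has_ubound S.
  exists (Num.sqrt (\sum_(i < d) enorm (row i A)^T ^+ 2)) => _ [w w1 <-].
  rewrite /enorm ler_sqrt; last by apply: sumr_ge0 => i _; rewrite sqr_ge0.
  apply: ler_sum => i _.
  have -> : (A *m w) i 0 = dot (row i A)^T w.
    by rewrite mxE; apply: eq_bigr => j _; rewrite !mxE.
  rewrite -real_normK ?num_real // ler_pXn2r ?nnegrE ?enorm_ge0 //.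
  apply: le_trans (Cauchy_Schwarz _ _) _.
  by rewrite ler_piMr ?enorm_ge0.
have [v0|v0] := eqVneq (enorm v) 0.
  by rewrite (enorm_eq0 v0) mulmx0 !enorm0 mulr0.
have vp : 0 < enorm v by rewrite lt_def v0 enorm_ge0.
rewrite -ler_pdivrMr //.
have -> : enorm (A *m v) / enorm v = enorm (A *m ((enorm v)^-1 *: v)).
  by rewrite -scalemxAr enormZ gtr0_norm ?invr_gt0 // mulrC.
apply: ub_le_sup => //; exists ((enorm v)^-1 *: v) => //=.
by rewrite enormZ gtr0_norm ?invr_gt0 // mulVf.
Qed.

(** Outside the ball the radial point [(r / |z|) z] attains the minimum, so the
    choice that defines [proj_ball] is made among actual minimizers. *)
Lemma proj_ball_min d (r : R) (z : 'cV[R]_d) : 0 <= r ->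
  enorm (proj_ball r z) <= r /\
  forall w, enorm w <= r -> enorm (proj_ball r z - z) <= enorm (w - z).
Proof.
move=> r0.
suff [w hw] : exists w, enorm w <= r /\
    forall w', enorm w' <= r -> enorm (w - z) <= enorm (w' - z).
  by have := @getPex _ [set w | enorm w <= r /\
    forall w', enorm w' <= r -> enorm (w - z) <= enorm (w' - z)]%classic
    (ex_intro _ w hw).
have [zr|rz] := leP (enorm z) r.
  by exists z; split=> // w' _; rewrite subrr enorm0 enorm_ge0.
have z0 : 0 < enorm z by apply: le_lt_trans rz.
exists ((r / enorm z) *: z); split.
  by rewrite enormZ ger0_norm ?divr_ge0 ?enorm_ge0 // divfK // gt_eqF.
move=> w' w'r.
have -> : (r / enorm z) *: z - z = (r / enorm z - 1) *: z.
  by rewrite scalerBl scale1r.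
rewrite enormZ ler0_norm; last first.
  by rewrite subr_le0 ler_pdivrMr // mul1r ltW.
rewrite opprB mulrBl mul1r divfK ?gt_eqF //.
have := ler_enormD (z - w') w'; rewrite subrK enormB; lra.
Qed.

(** By minimality along the segment from the projection [w0] to [w], the vectors
    [z - w0] and [w - w0] make an obtuse angle; the claim then follows by
    expanding [|z - w|^2]. *)
Lemma proj_ball_nonexp d (r : R) (z w : 'cV[R]_d) : 0 <= r -> enorm w <= r ->
  enorm (proj_ball r z - w) <= enorm (z - w).
Proof.
move=> r0 wr; have [] := proj_ball_min z r0; set w0 := proj_ball r z => w0r w0m.
(* Compare w0 with w0 + t (w - w0) and let t tend to 0. *)
have h t : 0 < t <= 1 -> dot (w0 - z) (w0 - w) <= 0 + t * dot (w - w0) (w - w0).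
  move=> /andP[t0 t1].
  have : enorm (w0 + t *: (w - w0)) <= r.
    have -> : w0 + t *: (w - w0) = (1 - t) *: w0 + t *: w.
      by vring.
    apply: le_trans (ler_enormD _ _) _; rewrite !enormZ.
    rewrite (gtr0_norm t0) ger0_norm ?subr_ge0 //.
    have : (1 - t) * enorm w0 <= (1 - t) * r by rewrite ler_wpM2l ?subr_ge0.
    have : t * enorm w <= t * r by rewrite ler_wpM2l // ltW.
    lra.
  move=> /w0m; rewrite enorm_mono.
  rewrite (_ : w0 + t *: (w - w0) - z = (w0 - z) + t *: (w - w0)); last first.
    by rewrite addrAC.
  rewrite -[w0 - w]opprB dotNr.
  move: (w0 - z) (w - w0) => a b.
  rewrite dotDl !dotDr !dotZl !dotZr [dot b a]dotC => h.
  have b0 := dotvv_ge0 b.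
  have : 0 <= t * (2 * dot a b + t * dot b b) by lra.
  rewrite pmulr_rge0 // => h2.
  have : 0 <= t * dot b b by rewrite mulr_ge0 // ltW.
  lra.
have {}h : dot (w0 - z) (w0 - w) <= 0 by apply: le_of_le_addM h.
rewrite enorm_mono.
have -> : z - w = (w0 - w) - (w0 - z) by vring.
move: h (dotvv_ge0 (w0 - z)); move: (w0 - z) (w0 - w) => a b.
by rewrite dotBl !dotBr [dot b a]dotC; lra.
Qed.

End EuclideanSpace.

(** * Differential calculus with explicit remainders *)

Section Calculus.
Context {R : realType}.

Lemma derive_grad d (phi : 'cV[R]_d -> R) u v : differentiable phi u ->
  'D_v phi u = dot (grad phi u) v.
Proof.
move=> dphi; rewrite deriveE //.
have -> : v = \sum_(i < d) v i 0 *: delta_mx i 0.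
  rewrite {1}[v]matrix_sum_delta; apply: eq_bigr => i _.
  by rewrite big_ord_recl big_ord0 addr0 (_ : ord0 = 0).
rewrite linear_sum /dot; apply: eq_bigr => i _.
rewrite linearZ /= -deriveE // mxE summxE (bigD1 i) //= !mxE !eqxx mulr1.
rewrite big1 ?addr0 1?mulrC // => j ji.
by rewrite !mxE eq_sym (negbTE ji) mulr0.
Qed.

Lemma is_derive_line d (phi : 'cV[R]_d -> R) u v (t : R) :
  differentiable phi (u + t *: v) ->
  is_derive t 1 (fun s : R => phi (u + s *: v)) (dot (grad phi (u + t *: v)) v).
Proof.
move=> dphi.
have E : (fun h : R => h^-1 *: (((fun s : R => phi (u + s *: v)) \o shift t) (h *: 1)
      - phi (u + t *: v))) =
    (fun h : R => h^-1 *: ((phi \o shift (u + t *: v)) (h *: v) - phi (u + t *: v))).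
  apply/funext => h /=; congr (_ *: (phi _ - _)).
  by rewrite /shift /= [h%:A]mulr1 scalerDl addrCA.
apply: DeriveDef.
  rewrite /derivable E; exact: (diff_derivable (v := v) dphi).
by rewrite -(derive_grad v dphi) /derive E.
Qed.

(** The increment of a difference of two copies of [phi], which is what the second
    difference in the proof of Schwarz's theorem is. *)
Lemma MVT_line2 d (phi : 'cV[R]_d -> R) u u' v : (forall w, differentiable phi w) ->
  exists2 c : R, 0 < c < 1 &
    phi (u + v) - phi (u' + v) - (phi u - phi u') =
    dot (grad phi (u + c *: v) - grad phi (u' + c *: v)) v.
Proof.
move=> dphi.
have dl t := is_deriveB (is_derive_line (dphi (u + t *: v)))
  (is_derive_line (dphi (u' + t *: v))).
have := @MVT R _ _ 0 1 ltr01 (fun t _ => dl t).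
case=> [|c c01].
  apply: derivable_within_continuous => t _.
  by case: (dl t).
rewrite subr0 mulr1 -dotBl /= !fctE /= !scale1r !scale0r !addr0 => E.
by exists c => //; move: c01; rewrite in_itv.
Qed.

Lemma MVT_line d (phi : 'cV[R]_d -> R) u v : (forall w, differentiable phi w) ->
  exists2 c : R, 0 < c < 1 & phi (u + v) - phi u = dot (grad phi (u + c *: v)) v.
Proof.
move=> dphi.
have dl t := is_derive_line (dphi (u + t *: v)).
have := @MVT R (fun s => phi (u + s *: v)) _ 0 1 ltr01 (fun t _ => dl t).
case=> [|c c01].
  apply: derivable_within_continuous => t _.
  by case: (dl t).
rewrite subr0 mulr1 scale1r scale0r addr0 => E.
by exists c => //; move: c01; rewrite in_itv.
Qed.

Lemma differentiable_wsum d n (w : 'I_n -> R) (F : 'I_n -> 'cV[R]_d -> R) u :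
  (forall i, differentiable (F i) u) ->
  differentiable (fun u => \sum_(i < n) w i * F i u) u.
Proof.
move=> dF; rewrite (_ : (fun _ => _) = \sum_(i < n) (w i *: F i)); last first.
  by apply/funext => x; rewrite fct_sumE.
by apply: differentiable_sum => i; exact: differentiableZ.
Qed.

Lemma grad_wsum d n (w : 'I_n -> R) (F : 'I_n -> 'cV[R]_d -> R) u :
  (forall i, differentiable (F i) u) ->
  grad (fun u => \sum_(i < n) w i * F i u) u = \sum_(i < n) w i *: grad (F i) u.
Proof.
move=> dF; rewrite (_ : (fun _ => _) = \sum_(i < n) (w i *: F i)); last first.
  by apply/funext => x; rewrite fct_sumE.
apply/matrixP => j k; rewrite ord1 summxE mxE derive_sum; last first.
  by move=> i; apply: derivableZ; exact: diff_derivable.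
apply: eq_bigr => i _; rewrite !mxE deriveZ //.
exact: diff_derivable.
Qed.

Lemma differentiable_gradi d (phi : 'cV[R]_d -> R) u i :
  differentiable (grad phi) u -> differentiable (fun u => grad phi u i 0) u.
Proof.
move=> dg; apply: (differentiable_comp (g := fun N : 'cV[R]_d => N i 0)) => //.
exact: differentiable_coord.
Qed.

Lemma hess_wsum d n (w : 'I_n -> R) (F : 'I_n -> 'cV[R]_d -> R) u :
  (forall i u, differentiable (F i) u) ->
  (forall i, differentiable (grad (F i)) u) ->
  hess (fun u => \sum_(i < n) w i * F i u) u = \sum_(i < n) w i *: hess (F i) u.
Proof.
move=> dF ddF; apply/matrixP => k l; rewrite mxE summxE.
have -> : (fun u' => grad (fun u => \sum_(i < n) w i * F i u) u' k 0) =
    (fun u' => \sum_(i < n) w i * grad (F i) u' k 0).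
  by apply/funext => x; rewrite grad_wsum // summxE; apply: eq_bigr => i _; rewrite mxE.
have dk i := differentiable_gradi k (ddF i).
rewrite derive_grad ?dot_delta; last exact: differentiable_wsum.
rewrite grad_wsum // summxE; apply: eq_bigr => i _.
by rewrite !mxE.
Qed.

Lemma lipschitz_gradW d (L L' : R) (phi : 'cV[R]_d -> R) :
  L <= L' -> lipschitz_grad L phi -> lipschitz_grad L' phi.
Proof.
move=> LL' [dphi lip]; split=> // u u'; apply: le_trans (lip u u') _.
by rewrite ler_wpM2r ?enorm_ge0.
Qed.

Lemma lipschitz_hessW d (L L' : R) (phi : 'cV[R]_d -> R) :
  L <= L' -> lipschitz_hess L phi -> lipschitz_hess L' phi.
Proof.
move=> LL' [dphi ddphi lip]; split=> // u u'; apply: le_trans (lip u u') _.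
by rewrite ler_wpM2r ?enorm_ge0.
Qed.

(** The factor 1/2 of the sharp estimate is lost to the mean value theorem. *)
Lemma taylor1 d (L : R) (phi : 'cV[R]_d -> R) u h : 0 <= L ->
  lipschitz_grad L phi ->
  `|phi (u + h) - phi u - dot (grad phi u) h| <= L * enorm h ^+ 2.
Proof.
move=> L0 [dphi lip]; have [c /andP[c0 c1] ->] := MVT_line u h dphi.
rewrite -dotBl; apply: le_trans (Cauchy_Schwarz _ _) _.
rewrite expr2 mulrA ler_wpM2r ?enorm_ge0 //.
apply: le_trans (lip _ _) _; rewrite addrC addKr.
by rewrite ler_wpM2l // enormZ gtr0_norm // ler_piMl ?enorm_ge0 // ltW.
Qed.

Section Hessian.
Variables (d : nat) (L : R) (phi : 'cV[R]_d -> R).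
Hypotheses (L0 : 0 <= L) (lip_hess : lipschitz_hess L phi).

Lemma MVT_grad u h w : exists2 c : R, 0 < c < 1 &
  dot (grad phi (u + h) - grad phi u) w = dot (hess phi (u + c *: h) *m h) w.
Proof.
have [_ ddphi _] := lip_hess.
have dk i x := differentiable_gradi i (ddphi x).
have [c c01] := MVT_line u h (fun x => differentiable_wsum (fun i => w i 0)
  (fun i => dk i x)).
rewrite grad_wsum; last by move=> i; exact: dk.
move=> E; exists c => //; rewrite dotC dotBr.
move: E; rewrite -/(dot w _) -/(dot w _) => ->.
rewrite [RHS]dotC dot_mulmx; congr (dot _ _).
apply/matrixP => i j; rewrite ord1 summxE mxE.
by apply: eq_bigr => k _; rewrite !mxE mulrC.
Qed.

Lemma enorm_hessB u u' v :
  enorm ((hess phi u - hess phi u') *m v) <= L * enorm (u - u') * enorm v.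
Proof.
have [_ _ lip] := lip_hess.
by apply: le_trans (enorm_mulmx _ _) _; rewrite ler_wpM2r ?enorm_ge0.
Qed.

Lemma taylor_grad u h :
  enorm (grad phi (u + h) - grad phi u - hess phi u *m h) <= L * enorm h ^+ 2.
Proof.
apply: enorm_le_dot => [|w]; first by rewrite mulr_ge0 // sqr_ge0.
have [c /andP[c0 c1] E] := MVT_grad u h w.
rewrite dotBl E -dotBl -mulmxBl; apply: le_trans (dot_le_enorm _ _) _.
rewrite ler_wpM2r ?enorm_ge0 //; apply: le_trans (enorm_hessB _ _ _) _.
rewrite addrC addKr expr2 mulrA ler_wpM2r ?enorm_ge0 //.
by rewrite ler_wpM2l // enormZ gtr0_norm // ler_piMl ?enorm_ge0 // ltW.
Qed.

Lemma taylor_grad_dot u h w :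
  `|dot (grad phi (u + h) - grad phi u - hess phi u *m h) w|
    <= L * enorm h ^+ 2 * enorm w.
Proof.
apply: le_trans (Cauchy_Schwarz _ _) _.
by rewrite ler_wpM2r ?enorm_ge0 ?taylor_grad.
Qed.

(** Schwarz's theorem: the mixed second difference
    [phi (u + t v + t w) - phi (u + t v) - phi (u + t w) + phi u] is symmetric in
    [v] and [w], and equals [t^2 <hess v, w>] up to [O(t^3)] by the mean value
    theorem in the direction [w]. *)
Lemma hess_sym u : (hess phi u)^T = hess phi u.
Proof.
have [dphi ddphi _] := lip_hess.
pose dd (v w : 'cV[R]_d) := phi (u + v + w) - phi (u + v) - phi (u + w) + phi u.
pose C (v w : 'cV[R]_d) := (L * (enorm v + enorm w) ^+ 2 + L * enorm w ^+ 2) * enorm w.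
have ddE (v w : 'cV[R]_d) (t : R) : 0 < t <= 1 ->
    `|dd (t *: v) (t *: w) - t ^+ 2 * dot (hess phi u *m v) w| <= t ^+ 3 * C v w.
  move=> /andP[t0 t1].
  have [c /andP[c0 c1]] := MVT_line2 (u + t *: v) u (t *: w) dphi.
  rewrite (_ : _ - _ = dd (t *: v) (t *: w)); last by rewrite /dd; ring.
  move=> ->.
  have e1 := taylor_grad_dot u (t *: v + (c * t) *: w) (t *: w).
  have e2 := taylor_grad_dot u ((c * t) *: w) (t *: w).
  have n1 : enorm (t *: v + (c * t) *: w) <= t * (enorm v + enorm w).
    apply: le_trans (ler_enormD _ _) _; rewrite !enormZ mulrDr.
    rewrite (gtr0_norm t0) gtr0_norm ?mulr_gt0 // lerD2l -mulrA ler_piMl ?(ltW c1) //.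
    by rewrite mulr_ge0 ?enorm_ge0 // ltW.
  have n2 : enorm ((c * t) *: w) <= t * enorm w.
    rewrite enormZ gtr0_norm ?mulr_gt0 // -mulrA ler_piMl ?(ltW c1) //.
    by rewrite mulr_ge0 ?enorm_ge0 // ltW.
  have n3 : enorm (t *: w) = t * enorm w by rewrite enormZ gtr0_norm.
  have -> : dot (grad phi (u + t *: v + c *: (t *: w)) - grad phi (u + c *: (t *: w)))
      (t *: w) - t ^+ 2 * dot (hess phi u *m v) w =
    dot (grad phi (u + (t *: v + (c * t) *: w)) - grad phi u -
      hess phi u *m (t *: v + (c * t) *: w)) (t *: w) -
    dot (grad phi (u + (c * t) *: w) - grad phi u -
      hess phi u *m ((c * t) *: w)) (t *: w).
    rewrite scalerA (addrA u (t *: v)) mulmxDr -!scalemxAr.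
    by rewrite !(dotDl, dotNl, dotZl, dotZr); ring.
  apply: le_trans (ler_normB _ _) _.
  have -> : t ^+ 3 * C v w = L * (t * (enorm v + enorm w)) ^+ 2 * (t * enorm w) +
      L * (t * enorm w) ^+ 2 * (t * enorm w) by rewrite /C; ring.
  have tw : 0 <= t * enorm w by rewrite mulr_ge0 ?enorm_ge0 // ltW.
  have mono A B : 0 <= A -> A <= B ->
      L * A ^+ 2 * (t * enorm w) <= L * B ^+ 2 * (t * enorm w).
    move=> A0 AB; rewrite ler_wpM2r // ler_wpM2l // ler_pXn2r ?nnegrE //.
    exact: le_trans AB.
  rewrite n3 in e1 e2; apply: lerD.
    by apply: le_trans e1 _; apply: mono; rewrite ?enorm_ge0.
  by apply: le_trans e2 _; apply: mono; rewrite ?enorm_ge0.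
have ddC v w : dd v w = dd w v by rewrite /dd [u + v + w]addrAC; ring.
have sym v w : dot (hess phi u *m v) w <= dot (hess phi u *m w) v.
  apply: (@le_of_le_addM _ _ _ (C v w + C w v)) => t t01.
  have := ddE v w t t01; have := ddE w v t t01; rewrite (ddC (t *: w)).
  move: (dd _ _) (dot _ _) (dot _ _) (C v w) (C w v) => X a b c1 c2.
  move: t01 => /andP[t0 _].
  rewrite !ler_norml => /andP[A1 A2] /andP[B1 B2].
  have : t ^+ 2 * a <= t ^+ 2 * (b + t * (c1 + c2)).
    by move: A1 A2 B1 B2; rewrite (exprS t 2); lra.
  by rewrite (ler_pM2l (exprn_gt0 2 t0)).
apply/matrixP => i j; rewrite mxE.
have hE k l : dot (hess phi u *m delta_mx k 0) (delta_mx l 0) = hess phi u l k.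
  by rewrite dot_delta -colE mxE.
by apply/eqP; rewrite eq_le -2!hE !sym.
Qed.

Lemma dot_hess_sym u v w : dot (hess phi u *m v) w = dot v (hess phi u *m w).
Proof. by rewrite dot_mulmx hess_sym. Qed.

(** The difference quotients of the gradient are bounded by its Lipschitz
    constant. *)
Lemma enorm_hess (L1 : R) u v : 0 <= L1 -> lipschitz_grad L1 phi ->
  enorm (hess phi u *m v) <= L1 * enorm v.
Proof.
move=> L10 [_ lip].
apply: (@le_of_le_addM _ _ _ (L * enorm v ^+ 2)) => t /andP[t0 t1].
have := taylor_grad u (t *: v); have := lip (u + t *: v) u.
rewrite [u + _]addrC addrK -scalemxAr !enormZ gtr0_norm // => h1 h2.
have : enorm (t *: (hess phi u *m v)) <= L1 * (t * enorm v) + L * (t * enorm v) ^+ 2.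
  have -> : t *: (hess phi u *m v) = (grad phi (t *: v + u) - grad phi u) -
    (grad phi (t *: v + u) - grad phi u - t *: (hess phi u *m v)).
    by rewrite opprB addrC subrK.
  by apply: le_trans (ler_enormB _ _) _; exact: lerD.
rewrite enormZ gtr0_norm // => h3.
rewrite -(ler_pM2l t0); apply: le_trans h3 _; rewrite le_eqVlt; apply/orP; left.
by apply/eqP; ring.
Qed.

End Hessian.

End Calculus.

(** * The lower-level problem and the hypergradient *)

Section Blocks.
Context {R : realType} {dx dy : nat}.
Implicit Types (u : 'cV[R]_(dx + dy)) (H : 'M[R]_(dx + dy)).

Lemma dot_col_mxr u (a : 'cV[R]_dx) (b : 'cV[R]_dy) :
  dot u (col_mx a b) = dot (usubmx u) a + dot (dsubmx u) b.
Proof. by rewrite -{1}(vsubmxK u) dot_col_mx. Qed.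

Lemma dot_col_0mxr u (b : 'cV[R]_dy) : dot u (col_mx 0 b) = dot (dsubmx u) b.
Proof. by rewrite dot_col_mxr dot0r add0r. Qed.

Lemma ursubmx_mul H (z : 'cV[R]_dy) : ursubmx H *m z = usubmx (H *m col_mx 0 z).
Proof. by rewrite -{2}(submxK H) mul_block_col col_mxKu mulmx0 add0r. Qed.

Lemma drsubmx_mul H (z : 'cV[R]_dy) : drsubmx H *m z = dsubmx (H *m col_mx 0 z).
Proof. by rewrite -{2}(submxK H) mul_block_col col_mxKd mulmx0 add0r. Qed.

Lemma usubmxB u u' : usubmx (u - u') = usubmx u - usubmx u'.
Proof. by apply/matrixP => i j; rewrite !mxE. Qed.

Lemma dsubmxB u u' : dsubmx (u - u') = dsubmx u - dsubmx u'.
Proof. by apply/matrixP => i j; rewrite !mxE. Qed.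

Lemma dsubmxD u u' : dsubmx (u + u') = dsubmx u + dsubmx u'.
Proof. by apply/matrixP => i j; rewrite !mxE. Qed.

Lemma col_mxB (a a' : 'cV[R]_dx) (b b' : 'cV[R]_dy) :
  col_mx a b - col_mx a' b' = col_mx (a - a') (b - b').
Proof. by rewrite opp_col_mx add_col_mx. Qed.

Lemma enorm_col_mx_le (a : 'cV[R]_dx) (b : 'cV[R]_dy) :
  enorm (col_mx a b) <= enorm a + enorm b.
Proof.
have -> : col_mx a b = col_mx a 0 + col_mx 0 b by rewrite add_col_mx addr0 add0r.
by apply: le_trans (ler_enormD _ _) _; rewrite enorm_col_mx0 enorm_col_0mx.
Qed.

Lemma dsubmx_hessB H H' u z :
  dsubmx (u + (H - H') *m col_mx 0 z) =
  dsubmx u + (drsubmx H *m z - drsubmx H' *m z).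
Proof. by rewrite mulmxBl dsubmxD dsubmxB !drsubmx_mul. Qed.

(** The solution [z'] of a nearby linear system leaves in the first one a defect
    that comes only from the change of the data. *)
Lemma linear_system_defect H H' u u' z z' :
  drsubmx H' *m z' = dsubmx u' ->
  drsubmx H *m z - dsubmx u =
  drsubmx H *m (z - z') + dsubmx (u' - u + (H - H') *m col_mx 0 z').
Proof.
move=> E; rewrite dsubmx_hessB dsubmxB mulmxBr E.
by move: (_ *m z) (_ *m z') (dsubmx u) (dsubmx u') => a b c e; vring.
Qed.

Lemma linear_system_diff H H' u u' z z' :
  drsubmx H *m z = dsubmx u -> drsubmx H' *m z' = dsubmx u' ->
  drsubmx H *m (z' - z) = dsubmx (u' - u + (H - H') *m col_mx 0 z').
Proof.
move=> E E'; have := linear_system_defect H u z E'.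
by rewrite E subrr => /eqP; rewrite eq_sym addrC addr_eq0 -mulmxN opprB => /eqP.
Qed.

Lemma usubmx_direction_diff H H' u u' z z' :
  usubmx u - ursubmx H *m z - (usubmx u' - ursubmx H' *m z') =
  usubmx (u - u' - (H - H') *m col_mx 0 z' - H *m col_mx 0 (z - z')).
Proof.
have -> : col_mx 0 (z - z') = col_mx 0 z - col_mx 0 z' :> 'cV[R]_(dx + dy).
  by rewrite col_mxB subrr.
rewrite !ursubmx_mul mulmxBl mulmxBr !usubmxB.
move: (usubmx (_ *m _)) (usubmx (_ *m _)) (usubmx (_ *m _)).
by move: (usubmx u) (usubmx u') => a b c e k; vring.
Qed.

End Blocks.

(** A quadratic remainder determines the gradient. *)
Lemma grad_taylor {R : realType} d (phi : 'cV[R]_d -> R) x v M :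
  (forall h, `|phi (x + h) - phi x - dot v h| <= M * enorm h ^+ 2) ->
  grad phi x = v.
Proof.
move=> hM; apply/matrixP => i j; rewrite ord1 mxE.
apply: cvg_lim; first exact: Rhausdorff.
apply/cvgrPdist_le => e e0; near=> h.
have h0 : h != 0 by near: h; exact: nbhs_dnbhs_neq.
have hp : 0 < `|h| by rewrite normr_gt0.
have := hM (h *: delta_mx i 0).
rewrite dotZr dot_delta enormZ enorm_delta mulr1 [x + _]addrC /=.
set X := phi _ - phi x => hX.
have -> : v i 0 - h^-1 *: X = - (h^-1 * (X - h * v i 0)).
  by rewrite mulrBr mulrA mulVf // mul1r opprB.
rewrite normrN normrM normfV ler_pdivrMl //; apply: le_trans hX _.
rewrite expr2 mulrA mulrC; apply: ler_wpM2l => //.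
apply: le_trans (_ : (`|M| + 1) * `|h| <= e).
  by apply: ler_wpM2r => //; apply: le_trans (ler_norm M) _; rewrite lerDl.
have M0 : 0 < `|M| + 1 by apply: ltr_wpDl.
rewrite mulrC -ler_pdivlMr //; near: h; apply: dnbhs0_le.
by rewrite divr_gt0.
Unshelve. all: by end_near. Qed.

(** One constant [L] stands for all the Lipschitz constants.  The bound on the
    partial gradient of [f] is written [mu * r] so that [r] is both the bound on
    [zstar] and the radius of the projection. *)
Record bilevel_problem {R : realType} {dx dy : nat} (L mu r : R)
    (f g : 'cV[R]_(dx + dy) -> R) : Prop := BilevelProblem {
  ge1_L : 1 <= L;
  mu_gt0 : 0 < mu;
  mu_le_L : mu <= L;
  r_ge0 : 0 <= r;
  grad_f_lip : lipschitz_grad L f;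
  grad2_f_bound : forall x : 'cV[R]_dx,
    enorm (dsubmx (grad f (col_mx x (ystar g x)))) <= mu * r;
  grad_g_lip : lipschitz_grad L g;
  hess_g_lip : lipschitz_hess L g;
  g_convex : forall x : 'cV[R]_dx, strongly_convex mu (fun y => g (col_mx x y)) }.

Section LowerLevel.
Context {R : realType} {dx dy : nat} (L mu r : R) (f g : 'cV[R]_(dx + dy) -> R).
Hypothesis P : bilevel_problem L mu r f g.
Implicit Types (x : 'cV[R]_dx) (y : 'cV[R]_dy).

Let L0 : 0 <= L. Proof. exact: le_trans ler01 (ge1_L P). Qed.
Let mu0 : 0 < mu. Proof. exact: mu_gt0 P. Qed.
Let dg : lipschitz_grad L g. Proof. exact: grad_g_lip P. Qed.
Let ddg : lipschitz_hess L g. Proof. exact: hess_g_lip P. Qed.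

Definition grad2 x y := dsubmx (grad g (col_mx x y)).
Definition hess22 x y := drsubmx (hess g (col_mx x y)).

Lemma taylor_y x y h :
  `|g (col_mx x (y + h)) - g (col_mx x y) - dot (grad2 x y) h| <= L * enorm h ^+ 2.
Proof.
have := taylor1 (col_mx x y) (col_mx 0 h) L0 dg.
by rewrite add_col_mx addr0 enorm_col_0mx dot_col_0mxr.
Qed.

Lemma strong_convex_above_tangent x y h :
  g (col_mx x y) + dot (grad2 x y) h + mu / 2 * enorm h ^+ 2 <= g (col_mx x (y + h)).
Proof.
apply: (@le_of_le_addM _ _ _ ((L + mu / 2) * enorm h ^+ 2)) => t /andP[t0 t1].
have := g_convex P x (y + h) y (t := t); rewrite t1 ltW // => /(_ isT).
rewrite (_ : t *: (y + h) + (1 - t) *: y = y + t *: h); last by vring.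
rewrite [y + h - y]addrC addKr.
have := taylor_y x y (t *: h); rewrite dotZr enormZ (gtr0_norm t0) ler_norml.
move=> /andP[A _] B; rewrite -(ler_pM2l t0).
by move: A B; rewrite exprMn; lra.
Qed.

Lemma grad2_strongly_monotone x y h :
  mu * enorm h ^+ 2 <= dot (grad2 x (y + h) - grad2 x y) h.
Proof.
have := strong_convex_above_tangent x y h.
have := strong_convex_above_tangent x (y + h) (- h).
by rewrite addrK dotNr enormN dotBl; lra.
Qed.

(** Strong convexity makes [g(x, .)] exceed its value at 0 outside a box, where
    compactness gives a minimizer. *)
Lemma ystar_min x y : g (col_mx x (ystar g x)) <= g (col_mx x y).
Proof.
suff [y0 hy0] : exists y0, forall y, g (col_mx x y0) <= g (col_mx x y).
  have := @getPex _ [set y | [set: 'cV[R]_dy] y /\ forall y', [set: 'cV[R]_dy] y' ->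
      g (col_mx x y) <= g (col_mx x y')]%classic
    (ex_intro _ y0 (conj I (fun y' _ => hy0 y'))).
  by case=> _ /(_ y I).
pose phi (v : 'rV[R]_dy) := g (col_mx x v^T).
(* Outside the ball of radius rho, hence outside the box, g(x, .) exceeds its
   value at 0. *)
pose rho := 2 * enorm (grad2 x 0) / mu.
have rho0 : 0 <= rho by rewrite divr_ge0 ?mulr_ge0 ?enorm_ge0 // ltW.
pose A := [set v : 'rV[R]_dy | forall i, `[(- rho), rho]%classic (v ord0 i)]%classic.
have [] := @EVT_min_rV R dy phi A.
- by exists 0 => i /=; rewrite mxE in_itv /= oppr_le0 rho0.
- by apply: (@rV_compact _ _ (fun=> `[(- rho), rho]%classic)) => _; exact: segment_compact.
- apply: continuous_subspaceT => v; apply: continuous_comp; last first.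
    by apply: differentiable_continuous; have [] := dg.
  move=> B /nbhs_ballP[e e0 eB]; apply/nbhs_ballP; exists e => // v' [_ vv'].
  apply: eB; split=> // i j; rewrite !mxE; case: (fintype.split _) => k.
    exact: ballxx.
  by rewrite !mxE.
move=> c _ hc; exists c^T => y1.
have [yA|yA] := boolP (y1^T \in A); first by have := hc _ yA; rewrite /phi trmxK.
have c0 : g (col_mx x c^T) <= g (col_mx x 0).
  have := hc 0; rewrite /phi trmx0; apply; rewrite inE => i /=.
  by rewrite mxE in_itv /= oppr_le0 rho0.
apply: le_trans c0 _; have := strong_convex_above_tangent x 0 y1.
rewrite add0r.
have big : rho <= enorm y1.
  rewrite leNgt; apply/negP => small; move/negP: yA; apply; rewrite inE => i /=.
  rewrite mxE in_itv /= -ler_norml; apply: le_trans (ltW small).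
  rewrite -(dot_delta y1 i); apply: le_trans (Cauchy_Schwarz _ _) _.
  by rewrite enorm_delta mulr1.
have := Cauchy_Schwarz (grad2 x 0) y1; rewrite ler_norml => /andP[cs _].
have : enorm (grad2 x 0) * enorm y1 <= mu / 2 * enorm y1 ^+ 2.
  rewrite expr2 mulrA ler_wpM2r ?enorm_ge0 //.
  move: big; rewrite ler_pdivrMr //; lra.
lra.
Qed.

Lemma grad2_ystar x : grad2 x (ystar g x) = 0.
Proof.
set y := ystar g x; apply: enorm_eq0; apply/eqP.
rewrite eq_le enorm_ge0 andbT enorm_le // expr0n /=.
apply: (@le_of_le_addM _ _ _ (L * enorm (grad2 x y) ^+ 2)) => t /andP[t0 t1].
have := taylor_y x y (- (t *: grad2 x y)).
rewrite enormN dotNr dotZr enormZ (gtr0_norm t0) ler_norml => /andP[_ A].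
have B := ystar_min x (y - t *: grad2 x y).
rewrite -(ler_pM2l t0); move: A B; rewrite exprMn -/y; lra.
Qed.

Lemma enorm_grad2_le x y : enorm (grad2 x y) <= L * enorm (y - ystar g x).
Proof.
have [_ lip] := dg; rewrite -[grad2 x y]subr0 -(grad2_ystar x) -dsubmxB.
apply: le_trans (enorm_dsubmx _) _; apply: le_trans (lip _ _) _.
by rewrite col_mxB subrr enorm_col_0mx.
Qed.

Lemma grad2_ge x y :
  mu * enorm (y - ystar g x) ^+ 2 <= dot (grad2 x y) (y - ystar g x).
Proof.
have := grad2_strongly_monotone x (ystar g x) (y - ystar g x).
by rewrite grad2_ystar subr0 [_ + (y - _)]addrC subrK.
Qed.

Lemma ystar_lip x x' : enorm (ystar g x' - ystar g x) <= L / mu * enorm (x' - x).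
Proof.
set y := ystar g x; set y' := ystar g x'.
have [e0|e0] := eqVneq (enorm (y' - y)) 0.
  by rewrite e0 mulr_ge0 ?enorm_ge0 // divr_ge0 // ltW.
have ep : 0 < enorm (y' - y) by rewrite lt_def e0 enorm_ge0.
have := grad2_ge x y'; rewrite -[grad2 x y']subr0 -(grad2_ystar x') -dsubmxB.
move/le_trans/(_ (dot_le_enorm _ _)); rewrite expr2 mulrA ler_pM2r // => h.
rewrite mulrAC ler_pdivlMr // mulrC; apply: le_trans h _.
apply: le_trans (enorm_dsubmx _) _; have [_ lip] := dg; apply: le_trans (lip _ _) _.
by rewrite col_mxB subrr enorm_col_mx0 enormB.
Qed.

(** Strong convexity passes to the Hessian by a first order expansion of the
    strong monotonicity of the gradient. *)
Lemma hess22_ge x y w : mu * enorm w ^+ 2 <= dot (hess22 x y *m w) w.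
Proof.
apply: (@le_of_le_addM _ _ _ (L * enorm w ^+ 3)) => t /andP[t0 t1].
have := taylor_grad_dot L0 ddg (col_mx x y) (col_mx 0 (t *: w)) (col_mx 0 w).
rewrite add_col_mx addr0 !enorm_col_0mx dot_col_0mxr !dsubmxB -drsubmx_mul.
rewrite enormZ (gtr0_norm t0) -scalemxAr dotBl dotZl ler_norml => /andP[_ A].
have := grad2_strongly_monotone x y (t *: w); rewrite dotZr enormZ (gtr0_norm t0).
move=> B; have t2 : 0 < t ^+ 2 by rewrite exprn_gt0.
rewrite -(ler_pM2l t2).
have : t * (t * (enorm w * (mu * enorm w))) <= t * (dot (hess22 x y *m w) w * t + (L * (t * enorm w) ^+ 2 * enorm w)).
  move: A; rewrite /grad2 in B *; rewrite -/(hess22 x y) => A.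
  have {}A : t * dot (dsubmx (grad g (col_mx x (y + t *: w))) - dsubmx (grad g (col_mx x y))) w
    <= t * (t * dot (hess22 x y *m w) w + L * (t * enorm w) ^+ 2 * enorm w).
    by rewrite ler_pM2l //; lra.
  by apply: le_trans (le_trans A _); lra.
by rewrite (exprS (enorm w) 2); lra.
Qed.

Lemma enorm_hess22_ge x y w : mu * enorm w <= enorm (hess22 x y *m w).
Proof.
have [->|w0] := eqVneq (enorm w) 0; first by rewrite mulr0 enorm_ge0.
have wp : 0 < enorm w by rewrite lt_def w0 enorm_ge0.
have := le_trans (hess22_ge x y w) (dot_le_enorm _ _).
by rewrite expr2 mulrA ler_pM2r.
Qed.

Lemma enorm_hess22_le x y w : enorm (hess22 x y *m w) <= L * enorm w.
Proof.
rewrite drsubmx_mul; apply: le_trans (enorm_dsubmx _) _.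
by apply: le_trans (enorm_hess L0 ddg _ _ L0 dg) _; rewrite enorm_col_0mx.
Qed.

Lemma hess22_unit x y : hess22 x y \in unitmx.
Proof.
rewrite -unitmx_tr -row_free_unit -kermx_eq0; apply/eqP/row_matrixP => i; rewrite row0.
have := row_sub i (kermx (hess22 x y)^T) => /sub_kermxP.
move: (row i _) => v /(congr1 trmx); rewrite trmx_mul trmxK trmx0 => v0.
apply: (can_inj (@trmxK _ _ _)); rewrite trmx0; apply: enorm_eq0.
have := enorm_hess22_ge x y v^T; rewrite v0 enorm0 pmulr_rle0 // => h.
by apply/eqP; rewrite eq_le h enorm_ge0.
Qed.

(** The solution of the linear system that defines the hypergradient; the iterates
    [z_k] track it. *)
Definition zstar x :=
  invmx (hess22 x (ystar g x)) *m dsubmx (grad f (col_mx x (ystar g x))).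

(** The gradient of [hyper f g], see [grad_hyper]. *)
Definition hypergrad x :=
  usubmx (grad f (col_mx x (ystar g x))) -
  ursubmx (hess g (col_mx x (ystar g x))) *m zstar x.

Lemma hess22_zstar x :
  hess22 x (ystar g x) *m zstar x = dsubmx (grad f (col_mx x (ystar g x))).
Proof. by rewrite mulmxA mulmxV ?hess22_unit // mul1mx. Qed.

Lemma enorm_zstar x : enorm (zstar x) <= r.
Proof.
rewrite -(ler_pM2l mu0); apply: le_trans (enorm_hess22_ge x (ystar g x) _) _.
by rewrite hess22_zstar; exact: grad2_f_bound P x.
Qed.

Let q := L * (1 + r).

Lemma hess_z_diff (x x' : 'cV[R]_dx) (y y' : 'cV[R]_dy) z : enorm z <= r ->
  enorm ((hess g (col_mx x y) - hess g (col_mx x' y')) *m col_mx 0 z)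
    <= L * r * enorm (col_mx x y - col_mx x' y').
Proof.
move=> zr; apply: le_trans (enorm_hessB ddg _ _ _) _.
rewrite enorm_col_0mx -!mulrA ler_wpM2l // mulrC.
by rewrite ler_wpM2r ?enorm_ge0.
Qed.

Lemma zstar_lip x x' :
  enorm (zstar x' - zstar x) <= q * (1 + L / mu) / mu * enorm (x' - x).
Proof.
set u := col_mx x (ystar g x); set u' := col_mx x' (ystar g x').
have uu' : enorm (u - u') <= (1 + L / mu) * enorm (x' - x).
  rewrite enormB /u /u' col_mxB; apply: le_trans (enorm_col_mx_le _ _) _.
  by rewrite mulrDl mul1r lerD2l ystar_lip.
rewrite mulrAC ler_pdivlMr // mulrC.
apply: le_trans (enorm_hess22_ge x (ystar g x) _) _.
have -> : hess22 x (ystar g x) *m (zstar x' - zstar x) =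
    dsubmx ((grad f u' - grad f u) + (hess g u - hess g u') *m col_mx 0 (zstar x')).
  exact: linear_system_diff (hess22_zstar x) (hess22_zstar x').
apply: le_trans (enorm_dsubmx _) _; apply: le_trans (ler_enormD _ _) _.
have [_ lip] := grad_f_lip P.
have h1 := lip u' u; rewrite (enormB u' u) in h1.
have h2 := hess_z_diff x x' (ystar g x) (ystar g x') (enorm_zstar x').
apply: le_trans (lerD h1 h2) _; rewrite -/u -/u'.
apply: le_trans (_ : q * enorm (u - u') <= _).
  by rewrite /q mulrDr mulr1 mulrDl.
by rewrite -(mulrA q) ler_wpM2l // mulr_ge0 // addr_ge0 // (r_ge0 P).
Qed.

(** Implicit differentiation, without differentiating [ystar]: expanding the
    optimality condition [grad2 g = 0] between [x] and [x + h] and pairing it with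
    [zstar] eliminates the increment of [ystar] from the expansion of [f], up to a
    quadratic remainder.  This yields the gradient of [hyper f g] and at the same
    time the descent inequality. *)
Lemma hyper_taylor x (h : 'cV[R]_dx) :
  `|hyper f g (x + h) - hyper f g x - dot (hypergrad x) h|
    <= q * (1 + (L / mu) ^+ 2) * enorm h ^+ 2.
Proof.
pose y := ystar g x; pose y' := ystar g (x + h); pose u := col_mx x y.
pose w := col_mx h (y' - y); pose z := zstar x.
have uw : col_mx (x + h) y' = u + w by rewrite add_col_mx [y + _]addrC subrK.
have F := taylor1 u w L0 (grad_f_lip P).
have G := taylor_grad_dot L0 ddg u w (col_mx 0 z).
have w2 : enorm w ^+ 2 <= (1 + (L / mu) ^+ 2) * enorm h ^+ 2.
  rewrite sqr_enorm_col_mx mulrDl mul1r lerD2l -exprMn.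
  rewrite ler_pXn2r ?nnegrE ?enorm_ge0 //.
    by have := ystar_lip x (x + h); rewrite [x + h - x]addrC addKr.
  by rewrite mulr_ge0 ?enorm_ge0 // divr_ge0 // ltW.
have zr : enorm z <= r by exact: enorm_zstar.
have fE : dot (grad f u) w =
    dot (usubmx (grad f u)) h + dot (hess22 x y *m z) (y' - y).
  by rewrite dot_col_mxr hess22_zstar.
have gE : dot (grad g (u + w) - grad g u - hess g u *m w) (col_mx 0 z) =
    - (dot (ursubmx (hess g u) *m z) h + dot (hess22 x y *m z) (y' - y)).
  have E1 : dsubmx (grad g u) = 0 := grad2_ystar x.
  have E2 : dsubmx (grad g (u + w)) = 0 by rewrite -uw; exact: grad2_ystar.
  rewrite dotBl (dot_hess_sym L0 ddg).
  rewrite dot_col_0mxr dsubmxB E1 E2 subr0 dot0l sub0r; congr (- _).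
  by rewrite dotC dot_col_mxr ursubmx_mul drsubmx_mul.
rewrite gE enorm_col_0mx normrN in G.
rewrite [X in `|X|](_ : _ = (f (u + w) - f u - dot (grad f u) w) +
    (dot (ursubmx (hess g u) *m z) h + dot (hess22 x y *m z) (y' - y))); last first.
  rewrite fE /hyper -/y' -/y uw -/u /hypergrad -/y -/u -/z dotBl; ring.
apply: le_trans (ler_normD _ _) _; apply: le_trans (lerD F G) _.
have : L * enorm w ^+ 2 * enorm z <= L * enorm w ^+ 2 * r.
  by rewrite ler_wpM2l // mulr_ge0 // sqr_ge0.
have : q * enorm w ^+ 2 <= q * (1 + (L / mu) ^+ 2) * enorm h ^+ 2.
  by rewrite -(mulrA q) ler_wpM2l // mulr_ge0 // addr_ge0 // (r_ge0 P).
by rewrite /q; move: (enorm w ^+ 2) (enorm z) => a c; lra.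
Qed.

Lemma grad_hyper x : grad (hyper f g) x = hypergrad x.
Proof. exact: grad_taylor (hyper_taylor x). Qed.

(** * The three directions at the current point *)

Lemma Dx_error x y z :
  enorm ((D f g (x, y, z)).1.1 - hypergrad x) <=
    q * enorm (y - ystar g x) + L * enorm (z - zstar x).
Proof.
rewrite /= /hypergrad; set u := col_mx x y; set u' := col_mx x (ystar g x).
have -> : usubmx (grad f u) - ursubmx (hess g u) *m z -
    (usubmx (grad f u') - ursubmx (hess g u') *m zstar x) =
    usubmx ((grad f u - grad f u') - (hess g u - hess g u') *m col_mx 0 (zstar x) -
            hess g u *m col_mx 0 (z - zstar x)).
  exact: usubmx_direction_diff.
apply: le_trans (enorm_usubmx _) _; apply: le_trans (ler_enormB _ _) _.
have uu' : enorm (u - u') = enorm (y - ystar g x).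
  by rewrite /u /u' col_mxB subrr enorm_col_0mx.
apply: lerD; last first.
  by apply: le_trans (enorm_hess L0 ddg _ _ L0 dg) _; rewrite enorm_col_0mx.
apply: le_trans (ler_enormB _ _) _.
have [_ lip] := grad_f_lip P; have h1 := lip u u'.
have h2 := hess_z_diff x x y (ystar g x) (enorm_zstar x).
by apply: le_trans (lerD h1 h2) _; rewrite uu' /q mulrDr mulr1 mulrDl.
Qed.

(** Around its target, [D_z] is the strongly monotone field [hess22] up to an error
    governed by the inaccuracy of [y]. *)
Lemma Dz_decomp x y z : exists2 e,
  (D f g (x, y, z)).2 = hess22 x y *m (z - zstar x) + e &
  enorm e <= q * enorm (y - ystar g x).
Proof.
set u := col_mx x y; set u' := col_mx x (ystar g x).
exists (dsubmx (grad f u' - grad f u + (hess g u - hess g u') *m col_mx 0 (zstar x))).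
  exact: linear_system_defect (hess22_zstar x).
have uu' : enorm (u - u') = enorm (y - ystar g x).
  by rewrite /u /u' col_mxB subrr enorm_col_0mx.
apply: le_trans (enorm_dsubmx _) _; apply: le_trans (ler_enormD _ _) _.
have [_ lip] := grad_f_lip P; have h1 := lip u' u; rewrite (enormB u' u) in h1.
have h2 := hess_z_diff x x y (ystar g x) (enorm_zstar x).
by apply: le_trans (lerD h1 h2) _; rewrite uu' /q mulrDr mulr1 mulrDl.
Qed.

End LowerLevel.

(** * Decrease of the potential along one iteration *)

Section Contraction.
Context {R : realType}.

Lemma sqr_enorm_le d (u : 'cV[R]_d) a : enorm u <= a -> enorm u ^+ 2 <= a ^+ 2.
Proof.
by move=> ua; rewrite ler_pXn2r ?nnegrE ?enorm_ge0 ?(le_trans _ ua) ?enorm_ge0.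
Qed.

(** One inexact gradient step of length [b] on a [mu]-strongly monotone,
    [L]-Lipschitz field, followed by a displacement [e] of the target.  The three
    terms are the contraction, the direction error and the drift of the target. *)
Lemma tracking_step d (L mu b : R) (a G v p e : 'cV[R]_d) (dd : R) :
  0 < mu -> mu <= L -> 0 < b -> b * L ^+ 2 <= mu ->
  mu * enorm a ^+ 2 <= dot G a -> enorm G <= L * enorm a ->
  enorm p <= enorm (a - b *: v) -> enorm e ^+ 2 <= dd ->
  enorm (p + e) ^+ 2 <= (1 - b * mu / 4) * enorm a ^+ 2 +
    4 * b / mu * enorm (v - G) ^+ 2 + 5 / (b * mu) * dd.
Proof.
move=> mu0 muL b0 bL Ga GL pa ed.
have L0 : 0 < L by apply: lt_le_trans muL.
have bm0 : 0 < b * mu by rewrite mulr_gt0.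
have bm1 : b * mu <= 1.
  rewrite -(ler_pM2r mu0) mul1r; apply: le_trans bL.
  rewrite -mulrA ler_pM2l // -expr2 ler_pXn2r ?nnegrE //; exact: ltW.
have GL2 : enorm G ^+ 2 <= L ^+ 2 * enorm a ^+ 2.
  by rewrite -exprMn ler_pXn2r ?nnegrE ?enorm_ge0 // mulr_ge0 ?enorm_ge0 // ltW.
have pa2 : enorm p ^+ 2 <= enorm (a - b *: v) ^+ 2.
  by rewrite ler_pXn2r ?nnegrE ?enorm_ge0.
have step1 : enorm (a - b *: G) ^+ 2 <= (1 - b * mu) * enorm a ^+ 2.
  rewrite sqr_enorm !(dotBl, dotBr, dotZl, dotZr) [dot a G]dotC -!sqr_enorm.
  have : b * (mu * enorm a ^+ 2) <= b * dot G a by rewrite ler_pM2l.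
  have : b * (b * enorm G ^+ 2) <= b * (mu * enorm a ^+ 2).
    rewrite ler_pM2l //; apply: le_trans (_ : b * (L ^+ 2 * enorm a ^+ 2) <= _).
      by rewrite ler_pM2l.
    by rewrite mulrA ler_wpM2r ?sqr_ge0.
  lra.
have step2 : enorm (a - b *: v) ^+ 2 <=
    (1 - b * mu / 2) * enorm a ^+ 2 + 3 * b / mu * enorm (v - G) ^+ 2.
  have -> : a - b *: v = (a - b *: G) + b *: (G - v) by vring.
  have t0 : 0 < b * mu / 2 by rewrite divr_gt0.
  apply: le_trans (sqr_enormD_Young _ _ t0) _.
  rewrite enormZ gtr0_norm // (enormB G) exprMn; apply: lerD.
    apply: le_trans (_ : (1 + b * mu / 2) * ((1 - b * mu) * enorm a ^+ 2) <= _).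
      by rewrite ler_wpM2l // addr_ge0 // ltW.
    rewrite mulrA ler_wpM2r ?sqr_ge0 //.
    by have := sqr_ge0 (b * mu); lra.
  rewrite mulrA ler_wpM2r ?sqr_ge0 //.
  have -> : (1 + (b * mu / 2)^-1) * b ^+ 2 = (b * mu + 2) * b / mu.
    by field; rewrite !gt_eqF.
  by rewrite ler_wpM2r ?invr_ge0 ?(ltW mu0) // ler_wpM2r ?(ltW b0) //; lra.
have t0 : 0 < b * mu / 4 by rewrite divr_gt0.
apply: le_trans (sqr_enormD_Young _ _ t0) _.
have h1 : (1 + b * mu / 4) * enorm p ^+ 2 <= (1 + b * mu / 4) *
    ((1 - b * mu / 2) * enorm a ^+ 2 + 3 * b / mu * enorm (v - G) ^+ 2).
  by rewrite ler_wpM2l ?(le_trans pa2) // addr_ge0 // ltW.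
have h2 : (1 + (b * mu / 4)^-1) * enorm e ^+ 2 <= 5 / (b * mu) * dd.
  have dd0 : 0 <= dd by apply: le_trans ed; exact: sqr_ge0.
  apply: le_trans (_ : (1 + (b * mu / 4)^-1) * dd <= _).
    by rewrite ler_wpM2l // addr_ge0 // invr_ge0 ltW.
  rewrite ler_wpM2r // (_ : 1 + _ = (b * mu + 4) / (b * mu)).
    by rewrite ler_wpM2r ?invr_ge0 ?(ltW bm0) //; lra.
  by field; rewrite !gt_eqF.
apply: le_trans (lerD h1 h2) _; rewrite lerD2r mulrDr; apply: lerD.
  rewrite mulrA ler_wpM2r ?sqr_ge0 //.
  by have := sqr_ge0 (b * mu); lra.
rewrite mulrA ler_wpM2r ?sqr_ge0 // mulrA ler_wpM2r ?invr_ge0 ?(ltW mu0) //.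
by rewrite mulrA ler_wpM2r ?(ltW b0) //; lra.
Qed.

End Contraction.

Section OneStep.
Context {R : realType} {dx dy : nat} (L mu r : R) (f g : 'cV[R]_(dx + dy) -> R).
Hypothesis P : bilevel_problem L mu r f g.
Implicit Types (w v : Defs.point R dx dy).

Let L1 : 1 <= L. Proof. exact: ge1_L P. Qed.
Let L0 : 0 <= L. Proof. exact: le_trans ler01 L1. Qed.
Let mu0 : 0 < mu. Proof. exact: mu_gt0 P. Qed.
Let r0 : 0 <= r. Proof. exact: r_ge0 P. Qed.
Let q := L * (1 + r).
Let kappa := L / mu.
Let nu := q * (1 + L / mu) / mu.
Let Lq : L <= q. Proof. by rewrite ler_peMr // lerDl. Qed.
Let q1 : 1 <= q. Proof. exact: le_trans Lq. Qed.
Let q0 : 0 <= q. Proof. exact: le_trans Lq. Qed.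

Definition grad_sq w := enorm (hypergrad f g w.1.1) ^+ 2.
Definition y_sq w := enorm (w.1.2 - ystar g w.1.1) ^+ 2.
Definition z_sq w := enorm (w.2 - zstar f g w.1.1) ^+ 2.
Definition dir_sq w v := psqnorm (psub v (D f g w)).
Definition total_sq w v := grad_sq w + y_sq w + z_sq w + dir_sq w v.

Lemma y_sq_ge0 w : 0 <= y_sq w. Proof. exact: sqr_ge0. Qed.
Lemma z_sq_ge0 w : 0 <= z_sq w. Proof. exact: sqr_ge0. Qed.
Lemma grad_sq_ge0 w : 0 <= grad_sq w. Proof. exact: sqr_ge0. Qed.
Lemma psqnorm_ge0 w : 0 <= psqnorm w. Proof. by rewrite !addr_ge0 ?sqr_ge0. Qed.
Lemma dir_sq_ge0 w v : 0 <= dir_sq w v. Proof. exact: psqnorm_ge0. Qed.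

Lemma dir_sq_split w v : dir_sq w v =
  enorm (v.1.1 - (D f g w).1.1) ^+ 2 + enorm (v.1.2 - (D f g w).1.2) ^+ 2 +
  enorm (v.2 - (D f g w).2) ^+ 2.
Proof. by []. Qed.

Lemma vx_error w v :
  enorm (v.1.1 - hypergrad f g w.1.1) ^+ 2 <=
    2 * dir_sq w v + 4 * q ^+ 2 * (y_sq w + z_sq w).
Proof.
rewrite dir_sq_split; case: w => -[x y] z.
have := Dx_error P x y z; rewrite -/q.
move: (D f g (x, y, z)) => [[Dx Dy] Dz] /= h.
have -> : v.1.1 - hypergrad f g x = (v.1.1 - Dx) + (Dx - hypergrad f g x).
  by rewrite addrA subrK.
apply: le_trans (sqr_enormD2 _ _) _.
have : enorm (Dx - hypergrad f g x) ^+ 2 <=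
    (q * enorm (y - ystar g x) + q * enorm (z - zstar f g x)) ^+ 2.
  apply: sqr_enorm_le; apply: le_trans h _.
  by rewrite lerD2l ler_wpM2r ?enorm_ge0.
rewrite /y_sq /z_sq /=.
have := sqr_ge0 (q * enorm (y - ystar g x) - q * enorm (z - zstar f g x)).
have := sqr_ge0 (enorm (v.1.2 - Dy)); have := sqr_ge0 (enorm (v.2 - Dz)).
move: (enorm (v.1.1 - Dx) ^+ 2) (enorm (v.1.2 - Dy) ^+ 2) (enorm (v.2 - Dz) ^+ 2).
move: (enorm (Dx - _) ^+ 2) (enorm (y - _)) (enorm (z - _)) => e a b s t u; lra.
Qed.

Lemma vx_bound w v : enorm v.1.1 ^+ 2 <= 8 * q ^+ 2 * total_sq w v.
Proof.
rewrite -(subrK (hypergrad f g w.1.1) v.1.1).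
apply: le_trans (sqr_enormD2 _ _) _; have := vx_error w v.
rewrite /total_sq -/(grad_sq w).
have q2 : 1 <= q ^+ 2 by rewrite exprn_ege1.
have := grad_sq_ge0 w; have := dir_sq_ge0 w v.
have := y_sq_ge0 w; have := z_sq_ge0 w.
move: q2; move: (q ^+ 2) (enorm (_ - _) ^+ 2) (grad_sq w) (dir_sq w v) (y_sq w) (z_sq w).
by move=> a b c d e k; nra.
Qed.

Lemma vy_bound w v : enorm v.1.2 ^+ 2 <= 8 * q ^+ 2 * total_sq w v.
Proof.
have q2 : 1 <= q ^+ 2 by rewrite exprn_ege1.
have := grad_sq_ge0 w; have := z_sq_ge0 w; have := y_sq_ge0 w.
rewrite /total_sq dir_sq_split; case: w => -[x y] z.
have : enorm (D f g (x, y, z)).1.2 ^+ 2 <= q ^+ 2 * y_sq (x, y, z).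
  rewrite -exprMn; apply: sqr_enorm_le; apply: le_trans (enorm_grad2_le P x y) _.
  by rewrite ler_wpM2r ?enorm_ge0.
move: (D f g (x, y, z)) => [[Dx Dy] Dz] /=.
have -> : v.1.2 = (v.1.2 - Dy) + Dy by rewrite subrK.
move=> h1 h2 h3 h4; apply: le_trans (sqr_enormD2 _ _) _; rewrite addrK.
have := sqr_ge0 (enorm (v.1.1 - Dx)); have := sqr_ge0 (enorm (v.2 - Dz)).
have := sqr_ge0 (enorm (v.1.2 - Dy)).
move: q2 h1 h2 h3 h4; move: (q ^+ 2) (enorm Dy ^+ 2) (y_sq _) (z_sq _) (grad_sq _).
move: (enorm (_ - Dx) ^+ 2) (enorm (_ - Dy) ^+ 2) (enorm (_ - Dz) ^+ 2).
by move=> a b c d e h i j; nra.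
Qed.

Lemma vz_error w v :
  enorm (v.2 - hess22 g w.1.1 w.1.2 *m (w.2 - zstar f g w.1.1)) ^+ 2 <=
    2 * dir_sq w v + 2 * q ^+ 2 * y_sq w.
Proof.
rewrite dir_sq_split; case: w => -[x y] z.
have [e] := Dz_decomp P x y z; rewrite -/q.
move: (D f g (x, y, z)) => [[Dx Dy] Dz] /= -> he.
move: (hess22 g x y *m _) => A.
have -> : v.2 - A = (v.2 - (A + e)) + e by rewrite opprD addrA subrK.
apply: le_trans (sqr_enormD2 _ _) _.
have : enorm e ^+ 2 <= q ^+ 2 * y_sq (x, y, z).
  by rewrite -exprMn; exact: sqr_enorm_le.
have := sqr_ge0 (enorm (v.1.1 - Dx)); have := sqr_ge0 (enorm (v.1.2 - Dy)).
move: (enorm (_ - _) ^+ 2) (enorm e ^+ 2) (enorm (_ - Dx) ^+ 2) (enorm (_ - Dy) ^+ 2).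
by move: (q ^+ 2) (y_sq _) => t y0 a b c d; lra.
Qed.

Lemma vz_bound w v : enorm v.2 ^+ 2 <= 8 * q ^+ 2 * total_sq w v.
Proof.
have := vz_error w v.
have : enorm (hess22 g w.1.1 w.1.2 *m (w.2 - zstar f g w.1.1)) ^+ 2 <= q ^+ 2 * z_sq w.
  rewrite -exprMn; apply: sqr_enorm_le; apply: le_trans (enorm_hess22_le P _ _ _) _.
  by rewrite ler_wpM2r ?enorm_ge0.
move: (hess22 _ _ _ *m _) => A h1 h2.
rewrite -(subrK A v.2); apply: le_trans (sqr_enormD2 _ _) _.
rewrite /total_sq.
have q2 : 1 <= q ^+ 2 by rewrite exprn_ege1.
have := grad_sq_ge0 w; have := dir_sq_ge0 w v.
have := y_sq_ge0 w; have := z_sq_ge0 w.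
move: q2 h1 h2; move: (q ^+ 2) (enorm A ^+ 2) (enorm (_ - A) ^+ 2).
by move: (grad_sq w) (dir_sq w v) (y_sq w) (z_sq w) => a b c d e h i; nra.
Qed.

Definition advance (a b c : R) w v : Defs.point R dx dy :=
  (w.1.1 - a *: v.1.1, w.1.2 - b *: v.1.2, proj_ball r (w.2 - c *: v.2)).

Lemma hyper_descent (a : R) w v : 0 <= a ->
  a * (q * (1 + kappa ^+ 2)) <= 1 / 2 ->
  hyper f g (w.1.1 - a *: v.1.1) <= hyper f g w.1.1 - a / 2 * grad_sq w +
    a * (dir_sq w v + 2 * q ^+ 2 * (y_sq w + z_sq w)).
Proof.
move=> a0 aM; have := vx_error w v.
have := hyper_taylor P w.1.1 (- (a *: v.1.1)).
rewrite -/q -/kappa ler_norml => /andP[_].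
rewrite enormN enormZ ger0_norm // dotNr dotZr.
rewrite /grad_sq (exprMn 2 a).
move: (hypergrad f g w.1.1) (v.1.1) => Phi vx.
rewrite (sqr_enorm (vx - _)) dotBl !dotBr -!sqr_enorm [dot Phi vx]dotC.
move: (hyper f g _) (hyper f g _) (enorm vx ^+ 2) (sqr_ge0 (enorm vx)).
move: (dot vx _) (enorm Phi ^+ 2) (dir_sq w v) (y_sq w + z_sq w).
move=> d G S YZ h' h V V0 A B.
have : a * (a * (q * (1 + kappa ^+ 2)) * V) <= a * (1 / 2 * V).
  by rewrite ler_wpM2l // ler_wpM2r.
have : a * (V - d - (d - G)) <= a * (2 * S + 4 * q ^+ 2 * YZ) by rewrite ler_wpM2l.
move: A; lra.
Qed.

Lemma y_step (a b c : R) w v : 0 < b -> b * L ^+ 2 <= mu ->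
  y_sq (advance a b c w v) <= (1 - b * mu / 4) * y_sq w + 4 * b / mu * dir_sq w v +
    5 / (b * mu) * (kappa ^+ 2 * (a ^+ 2 * enorm v.1.1 ^+ 2)).
Proof.
move=> b0 bL; rewrite dir_sq_split; case: w => -[x y] z; rewrite /y_sq /=.
set G := dsubmx _.
pose e := ystar g x - ystar g (x - a *: v.1.1).
have he : enorm e ^+ 2 <= kappa ^+ 2 * (a ^+ 2 * enorm v.1.1 ^+ 2).
  rewrite -(real_normK (num_real a)) -!exprMn -enormZ; apply: sqr_enorm_le.
  by have := ystar_lip P (x - a *: v.1.1) x; rewrite opprD opprK addrA subrr add0r.
have := tracking_step mu0 (mu_le_L P) b0 bL (grad2_ge P x y) (enorm_grad2_le P x y)
  (lexx _) he (v := v.1.2).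
rewrite (_ : y - ystar g x - b *: v.1.2 + e =
  y - b *: v.1.2 - ystar g (x - a *: v.1.1)); last first.
  by rewrite /e; move: (ystar g x) (ystar g _) => s t; vring.
move=> h; apply: le_trans h _; rewrite lerD2r lerD2l ler_wpM2l //.
  by rewrite divr_ge0 ?mulr_ge0 // ltW.
by rewrite addrAC lerDr addr_ge0 ?sqr_ge0.
Qed.

Lemma z_step (a b c : R) w v : 0 < c -> c * L ^+ 2 <= mu ->
  z_sq (advance a b c w v) <= (1 - c * mu / 4) * z_sq w +
    4 * c / mu * (2 * dir_sq w v + 2 * q ^+ 2 * y_sq w) +
    5 / (c * mu) * (nu ^+ 2 * (a ^+ 2 * enorm v.1.1 ^+ 2)).
Proof.
move=> c0 cL; have hG := vz_error w v; move: hG; case: w => -[x y] z.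
rewrite /z_sq /=; move: (dir_sq _ _) (y_sq _) => S Y hG.
pose e := zstar f g x - zstar f g (x - a *: v.1.1).
have he : enorm e ^+ 2 <= nu ^+ 2 * (a ^+ 2 * enorm v.1.1 ^+ 2).
  rewrite -(real_normK (num_real a)) -!exprMn -enormZ.
  apply: sqr_enorm_le.
  have E : x - (x - a *: v.1.1) = a *: v.1.1 by rewrite opprB addrC subrK.
  by rewrite -E; exact: zstar_lip P (x - a *: v.1.1) x.
pose p := proj_ball r (z - c *: v.2) - zstar f g x.
have hp : enorm p <= enorm (z - zstar f g x - c *: v.2).
  by rewrite addrAC; exact: proj_ball_nonexp (enorm_zstar P x).
have := tracking_step mu0 (mu_le_L P) c0 cL (hess22_ge P x y _) (enorm_hess22_le P x y _)
  hp he.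
rewrite (_ : p + e = proj_ball r (z - c *: v.2) - zstar f g (x - a *: v.1.1)); last first.
  by rewrite /p /e addrA subrK.
move=> h; apply: le_trans h _; rewrite lerD2r lerD2l ler_wpM2l //.
by rewrite divr_ge0 ?mulr_ge0 // ltW.
Qed.

(** A starting point outside the ball is first projected: the last term pays for
    this, and vanishes as soon as [w.2] lies in the ball. *)
Lemma movement (a b c : R) w v :
  psqnorm (psub (advance a b c w v) w) <=
    (a ^+ 2 + b ^+ 2 + 2 * c ^+ 2) * (8 * q ^+ 2 * total_sq w v) +
    8 * enorm (w.2 - proj_ball r w.2) ^+ 2.
Proof.
have hx := vx_bound w v; have hy := vy_bound w v; have hz := vz_bound w v.
move: (8 * q ^+ 2 * total_sq w v) hx hy hz => T hx hy hz.
rewrite /psqnorm /=.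
have sq (k : R) d (u : 'cV[R]_d) : enorm (k *: u) ^+ 2 = k ^+ 2 * enorm u ^+ 2.
  by rewrite enormZ exprMn real_normK ?num_real.
have xE d (u t : 'cV[R]_d) : u - t - u = - t by rewrite addrAC subrr add0r.
rewrite !xE !enormN !sq.
have hz' : enorm (proj_ball r (w.2 - c *: v.2) - w.2) ^+ 2 <=
    2 * (c ^+ 2 * enorm v.2 ^+ 2) + 8 * enorm (w.2 - proj_ball r w.2) ^+ 2.
  rewrite -sq; set p := proj_ball r w.2.
  have [pr _] := proj_ball_min w.2 r0; rewrite -/p in pr.
  have := proj_ball_nonexp (w.2 - c *: v.2) r0 pr.
  set p' := proj_ball r _; move=> h.
  have {}h : enorm (p' - w.2) <= enorm (c *: v.2) + 2 * enorm (w.2 - p).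
    rewrite (_ : p' - w.2 = (p' - p) + (p - w.2)); last by rewrite addrA subrK.
    apply: le_trans (ler_enormD _ _) _; rewrite (enormB p).
    suff : enorm (w.2 - c *: v.2 - p) <= enorm (c *: v.2) + enorm (w.2 - p) by lra.
    by rewrite addrAC addrC; apply: le_trans (ler_enormD _ _) _; rewrite enormN.
  have := enorm_ge0 (p' - w.2); have := enorm_ge0 (c *: v.2).
  move: h; have := enorm_ge0 (w.2 - p).
  move: (enorm _) (enorm _) (enorm _) => t u s s0 h t0 u0.
  have h2 : u ^+ 2 <= (t + 2 * s) ^+ 2.
    by rewrite ler_pXn2r ?nnegrE //; lra.
  by apply: le_trans h2 _; have := sqr_ge0 (t - 2 * s); lra.
have : a ^+ 2 * enorm v.1.1 ^+ 2 <= a ^+ 2 * T by rewrite ler_wpM2l ?sqr_ge0.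
have : b ^+ 2 * enorm v.1.2 ^+ 2 <= b ^+ 2 * T by rewrite ler_wpM2l ?sqr_ge0.
have : c ^+ 2 * enorm v.2 ^+ 2 <= c ^+ 2 * T by rewrite ler_wpM2l ?sqr_ge0.
move: hz'; move: (enorm _ ^+ 2) (enorm _ ^+ 2) (_ * enorm _ ^+ 2) (_ * enorm _ ^+ 2).
move: (_ * enorm _ ^+ 2) => A B D1 E1 F1; lra.
Qed.

End OneStep.

(** * Sampling without replacement *)

Lemma sumr_const_ord {R : realType} N (c : R) : \sum_(i < N) c = N%:R * c.
Proof. by rewrite sumr_const card_ord mulr_natl. Qed.

Section UniformBatch.
Context {R : realType} (N b : nat).
Hypotheses (b0 : (0 < b)%N) (bN : (b <= N)%N).

Let u (S : {set 'I_N}) : R := unif_batch b S.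

(** As a weighted sum over all indices, a minibatch mean is covered by the same
    linearity lemmas as the full mean. *)
Definition batch_weight (S : {set 'I_N}) (i : 'I_N) : R :=
  if i \in S then b%:R^-1 else 0.

Let bR : 0 < b%:R :> R. Proof. by rewrite ltr0n. Qed.
Let NR : 0 < N%:R :> R. Proof. by rewrite ltr0n (leq_trans b0). Qed.

Lemma unif_batch_ge0 S : 0 <= u S.
Proof. by rewrite /u /unif_batch; case: ifP => // _; rewrite invr_ge0 ler0n. Qed.

Lemma sum_unif_batch : \sum_S u S = 1.
Proof.
rewrite /u /unif_batch -big_mkcond /= sumr_const.
have -> : #|[pred S : {set 'I_N} | #|S| == b]| = 'C(N, b).
  by rewrite -[in RHS](card_ord N) -card_draws; apply: eq_card => S; rewrite !inE.
by rewrite -[_^-1 *+ _]mulr_natl mulfV // pnatr_eq0 -lt0n bin_gt0.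
Qed.

Lemma batch_weight_ge0 S i : 0 <= batch_weight S i.
Proof. by rewrite /batch_weight; case: ifP => // _; rewrite invr_ge0 ltW. Qed.

Lemma unif_batch_weight_sum S : u S * \sum_i batch_weight S i = u S.
Proof.
rewrite /u /unif_batch; case: eqP => [Sb|_]; last by rewrite mul0r.
rewrite /batch_weight -big_mkcond /= sumr_const Sb.
by rewrite -[_^-1 *+ _]mulr_natl mulfV ?mulr1 // gt_eqF.
Qed.

Lemma batch_weight_perm (s : {perm 'I_N}) (S : {set 'I_N}) i :
  batch_weight (s @: S) (s i) = batch_weight S i.
Proof. by rewrite /batch_weight mem_imset //; exact: perm_inj. Qed.

Lemma unif_batch_perm (s : {perm 'I_N}) (S : {set 'I_N}) : u (s @: S) = u S.
Proof. by rewrite /u /unif_batch card_imset //; exact: perm_inj. Qed.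

Lemma reindex_perm_batch (s : {perm 'I_N}) (X : {set 'I_N} -> R) :
  \sum_S X S = \sum_(S : {set 'I_N}) X (s @: S).
Proof. by rewrite (reindex_inj (imset_inj (@perm_inj _ s))). Qed.

(** By symmetry all indices have the same mean weight, and these sum to 1. *)
Lemma mean_batch_weight i : \sum_S u S * batch_weight S i = N%:R^-1.
Proof.
have E j : \sum_S u S * batch_weight S j = \sum_S u S * batch_weight S i.
  rewrite (reindex_perm_batch (tperm i j)); apply: eq_bigr => S _.
  by have := batch_weight_perm (tperm i j) S i; rewrite tpermL unif_batch_perm => ->.
apply: (mulfI (lt0r_neq0 NR)); rewrite mulfV ?lt0r_neq0 // -sumr_const_ord -[RHS]sum_unif_batch.
under eq_bigr => j _ do rewrite -(E j).
by rewrite exchange_big; apply: eq_bigr => S _; rewrite -mulr_sumr unif_batch_weight_sum.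
Qed.

Lemma perm_pair (i j k l : 'I_N) : i != j -> k != l ->
  exists s : {perm 'I_N}, s i = k /\ s j = l.
Proof.
move=> ij kl; exists (tperm i k * tperm (tperm i k j) l)%g; rewrite !permM; split.
  have jk : tperm i k j != k.
    by apply: contraNneq ij => /(canRL (tpermK i k)); rewrite tpermR => ->.
  by rewrite tpermL; move: (tperm i k j) jk => t tk; rewrite tpermD // eq_sym.
by rewrite tpermL.
Qed.

(** The weights of two distinct indices have the same nonnegative correlation for
    all pairs; for a centered family this correlation can only decrease the
    variance below that of independent draws. *)
Lemma mean_sqr_centered (a : 'I_N -> R) : \sum_i a i = 0 ->
  \sum_S u S * (\sum_i batch_weight S i * a i) ^+ 2 <=
    b%:R^-1 * (N%:R^-1 * \sum_i a i ^+ 2).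
Proof.
move=> a0; pose pi2 i j := \sum_S u S * (batch_weight S i * batch_weight S j).
have pi2E i j k l : i != j -> k != l -> pi2 i j = pi2 k l.
  move=> ij kl; have [s [<- <-]] := perm_pair ij kl.
  rewrite /pi2 [RHS](reindex_perm_batch s); apply: eq_bigr => S _.
  by rewrite unif_batch_perm !batch_weight_perm.
have pi2_ge0 i j : 0 <= pi2 i j.
  by apply: sumr_ge0 => S _; rewrite !mulr_ge0 ?unif_batch_ge0 ?batch_weight_ge0.
have [rho rho0 rhoE] : exists2 rho, 0 <= rho & forall i j, i != j -> pi2 i j = rho.
  case: (pickP [pred ij : 'I_N * 'I_N | ij.1 != ij.2]) => [[i j] /= ij|h].
    by exists (pi2 i j) => // k l kl; apply: pi2E.
  by exists 0 => // i j; have := h (i, j) => /= ->.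
have pi2D i : pi2 i i = b%:R^-1 * N%:R^-1.
  rewrite -(mean_batch_weight i) mulr_sumr; apply: eq_bigr => S _.
  by rewrite mulrCA /batch_weight; case: ifP => _; rewrite ?mulr0.
have -> : \sum_S u S * (\sum_i batch_weight S i * a i) ^+ 2 =
    \sum_i \sum_j pi2 i j * (a i * a j).
  under eq_bigr => S _ do rewrite expr2 mulr_suml mulr_sumr.
  rewrite exchange_big; apply: eq_bigr => i _.
  under eq_bigr => S _ do rewrite mulr_sumr mulr_sumr.
  rewrite exchange_big; apply: eq_bigr => j _.
  by rewrite mulr_suml; apply: eq_bigr => S _; ring.
have -> : \sum_i \sum_j pi2 i j * (a i * a j) =
    \sum_i (b%:R^-1 * N%:R^-1 - rho) * a i ^+ 2.
  apply: eq_bigr => i _.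
  have := congr1 (fun t => rho * (a i * t)) a0.
  rewrite /= !mulr0 (bigD1 i) //= => Ei.
  rewrite (bigD1 i) //= pi2D.
  under eq_bigr => j ji do rewrite rhoE 1?eq_sym //.
  rewrite -mulr_sumr -mulr_sumr; move: Ei; rewrite expr2; lra.
rewrite mulrA mulr_sumr; apply: ler_sum => i _.
by rewrite ler_wpM2r ?sqr_ge0 // gerBl.
Qed.

Definition batch_dev (a : 'I_N -> R) S :=
  \sum_i batch_weight S i * a i - \sum_i N%:R^-1 * a i.

Lemma mean_batch_dev a : \sum_S u S * batch_dev a S = 0.
Proof.
under eq_bigr => S _ do rewrite mulrBr.
rewrite sumrB -mulr_suml sum_unif_batch mul1r; apply/eqP; rewrite subr_eq0; apply/eqP.
under eq_bigr => S _ do rewrite mulr_sumr.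
rewrite exchange_big; apply: eq_bigr => i _.
by rewrite -(mean_batch_weight i) mulr_suml; apply: eq_bigr => S _; ring.
Qed.

Lemma mean_sqr_batch_dev a :
  \sum_S u S * batch_dev a S ^+ 2 <= b%:R^-1 * (N%:R^-1 * \sum_i a i ^+ 2).
Proof.
pose m := N%:R^-1 * \sum_i a i.
have c0 : \sum_i (a i - m) = 0.
  by rewrite sumrB sumr_const_ord /m mulrA mulfV ?gt_eqF // mul1r subrr.
have E S : u S * batch_dev a S ^+ 2 =
    u S * (\sum_i batch_weight S i * (a i - m)) ^+ 2.
  under [in RHS]eq_bigr => i _ do rewrite mulrBr.
  rewrite sumrB -mulr_suml /batch_dev -mulr_sumr -/m.
  have := unif_batch_weight_sum S; move: (\sum_i batch_weight S i) => t.
  have [->|u0] := eqVneq (u S) 0; first by rewrite !mul0r.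
  by rewrite -{2}[u S]mulr1 => /(mulfI u0) ->; rewrite mul1r.
under eq_bigr => S _ do rewrite E.
apply: le_trans (mean_sqr_centered c0) _.
rewrite ler_wpM2l ?invr_ge0 ?(ltW bR) // ler_wpM2l ?invr_ge0 ?(ltW NR) //.
under eq_bigr => i _ do rewrite sqrrB.
rewrite big_split sumrB /= sumr_const_ord.
have -> : \sum_i a i * m *+ 2 = N%:R * (m ^+ 2) *+ 2.
  rewrite sumrMnl -mulr_suml /m; move: (\sum_i a i) => t; congr (_ *+ 2).
  by field; rewrite gt_eqF.
have : 0 <= N%:R * m ^+ 2 by rewrite mulr_ge0 ?sqr_ge0 // ltW.
lra.
Qed.

End UniformBatch.

(** * The variance-reduced directions *)

Section OneSample.
Context {R : realType} {n m : nat} (b : nat) (p : R) (q : coins -> R).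
Hypotheses (b0 : (0 < b)%N) (bn : (b <= n)%N) (bm : (b <= m)%N).
Hypotheses (p1 : p <= 1) (hq : coin_law p q).

Local Notation sample := (@sample n m).
Local Notation pr := (sample_prob b q).

Lemma sample_prob_ge0 (s : sample) : 0 <= pr s.
Proof.
have [q0 _] := hq.
by rewrite /sample_prob !mulr_ge0 ?unif_batch_ge0.
Qed.

Lemma sum_sampleE (X : sample -> R) :
  \sum_s pr s * X s = \sum_c q c * \sum_S unif_batch b S *
    \sum_T unif_batch b T * X (c, S, T).
Proof.
pose Y (cS : coins * {set 'I_n}) (T : {set 'I_m}) := pr (cS, T) * X (cS, T).
transitivity (\sum_cS \sum_T Y cS T); first by rewrite (pair_bigA _ Y); apply: eq_bigr => -[].
pose Z (c : coins) (S : {set 'I_n}) := \sum_T Y (c, S) T.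
transitivity (\sum_c \sum_S Z c S); first by rewrite (pair_bigA _ Z); apply: eq_bigr => -[].
apply: eq_bigr => c _; rewrite mulr_sumr; apply: eq_bigr => S _.
rewrite mulr_sumr mulr_sumr; apply: eq_bigr => T _.
by rewrite /Y /sample_prob /=; ring.
Qed.

Lemma sum_sample_prob : \sum_(s : sample) pr s = 1.
Proof.
have [_ [q1 _ _ _]] := hq.
have := sum_sampleE (fun=> 1); under eq_bigr => s _ do rewrite mulr1.
move=> ->; rewrite -[RHS]q1; apply: eq_bigr => c _; rewrite -[RHS]mulr1; congr (_ * _).
rewrite -[RHS](sum_unif_batch (R := R) bn); apply: eq_bigr => S _.
rewrite -[RHS]mulr1; congr (_ * _).
rewrite -[RHS](sum_unif_batch (R := R) bm); apply: eq_bigr => T _; exact: mulr1.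
Qed.

Lemma sum_coin_tails (sel : coins -> bool) (V : R) :
  \sum_(c | sel c) q c = p ->
  \sum_c q c * (if sel c then 0 else V) = (1 - p) * V.
Proof.
have [_ [q1 _ _ _]] := hq.
move=> qp; rewrite -q1 (bigID sel) /= [in RHS](bigID sel) /= qp addrAC subrr add0r.
rewrite big1 ?add0r => [|c -> //]; last by rewrite mulr0.
by rewrite mulr_suml; apply: eq_bigr => c /negbTE ->.
Qed.

(** The terms linear in the deviations vanish on average; the product of the two
    deviations is absorbed into their squares, which costs the factor 2. *)
Lemma mean_sqr_two_batches (e : R) (a : 'I_n -> R) (a' : 'I_m -> R) :
  \sum_(S : {set 'I_n}) unif_batch b S * (\sum_(T : {set 'I_m}) unif_batch b T *
     (e + batch_dev b a S + batch_dev b a' T) ^+ 2) <=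
  e ^+ 2 + 2 / b%:R * (n%:R^-1 * \sum_i a i ^+ 2 + m%:R^-1 * \sum_j a' j ^+ 2).
Proof.
have V := mean_sqr_batch_dev b0 bn a; have V' := mean_sqr_batch_dev b0 bm a'.
have M := mean_batch_dev b0 bn a; have M' := mean_batch_dev b0 bm a'.
have inner (x : R) : \sum_(T : {set 'I_m}) unif_batch b T *
     (e + x + batch_dev b a' T) ^+ 2 <= e ^+ 2 + 2 * e * x + 2 * x ^+ 2 +
       2 * \sum_(T : {set 'I_m}) unif_batch b T * batch_dev b a' T ^+ 2.
  apply: le_trans (_ : \sum_(T : {set 'I_m}) unif_batch b T *
     (e ^+ 2 + 2 * e * x + 2 * x ^+ 2 + 2 * e * batch_dev b a' T +
      2 * batch_dev b a' T ^+ 2) <= _).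
    apply: ler_sum => T _; apply: ler_wpM2l; first exact: unif_batch_ge0.
    by have := sqr_ge0 (x - batch_dev b a' T); lra.
  under eq_bigr => T _ do rewrite mulrDr mulrDr.
  rewrite !big_split /= -mulr_suml sum_unif_batch // mul1r.
  under [X in _ + X + _ <= _]eq_bigr => T _ do rewrite mulrCA.
  under [X in _ + X <= _]eq_bigr => T _ do rewrite mulrCA.
  by rewrite -!mulr_sumr M' mulr0 addr0.
move: inner; set v' := (\sum_(T : {set 'I_m}) _ * _ ^+ 2) => inner.
apply: le_trans (_ : \sum_(S : {set 'I_n}) unif_batch b S *
   (e ^+ 2 + 2 * v' + 2 * e * batch_dev b a S + 2 * batch_dev b a S ^+ 2) <= _).
  apply: ler_sum => S _; apply: ler_wpM2l; first exact: unif_batch_ge0.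
  by apply: le_trans (inner _) _; lra.
under eq_bigr => S _ do rewrite mulrDr mulrDr.
rewrite !big_split /= -mulr_suml sum_unif_batch // mul1r.
under [X in _ + X + _ <= _]eq_bigr => S _ do rewrite mulrCA.
under [X in _ + X <= _]eq_bigr => S _ do rewrite mulrCA.
rewrite -!mulr_sumr M mulr0 addr0 mulrDr -!mulrA.
move: V V'; rewrite -/v'; lra.
Qed.

Definition wsum d N (w : 'I_N -> R) (a : 'I_N -> 'cV[R]_d) := \sum_i w i *: a i.

(** One component of the direction error: it is reset to 0 with probability [p],
    and otherwise keeps its old value [e] plus two centered independent
    perturbations. *)
Lemma mean_sqr_component d (sel : coins -> bool) (e : 'cV[R]_d)
    (a : 'I_n -> 'cV[R]_d) (a' : 'I_m -> 'cV[R]_d) (A A' : R) :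
  \sum_(c | sel c) q c = p ->
  (forall i, enorm (a i) ^+ 2 <= A) -> (forall j, enorm (a' j) ^+ 2 <= A') ->
  \sum_(s : sample) pr s * (if sel s.1.1 then 0 else
    enorm (e + (wsum (batch_weight b s.1.2) a - wsum (fun=> n%:R^-1) a) +
           (wsum (batch_weight b s.2) a' - wsum (fun=> m%:R^-1) a')) ^+ 2) <=
  (1 - p) * (enorm e ^+ 2 + 2 / b%:R * (A + A')).
Proof.
move=> qp aA aA'.
have n0 : 0 < n%:R :> R by rewrite ltr0n (leq_trans b0).
have m0 : 0 < m%:R :> R by rewrite ltr0n (leq_trans b0).
pose V S T := enorm (e + (wsum (batch_weight b S) a - wsum (fun=> n%:R^-1) a) +
           (wsum (batch_weight b T) a' - wsum (fun=> m%:R^-1) a')) ^+ 2.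
rewrite sum_sampleE /=.
have -> : \sum_c q c * (\sum_S unif_batch b S * (\sum_T unif_batch b T *
    (if sel c then 0 else V S T))) =
    (1 - p) * \sum_S unif_batch b S * (\sum_T unif_batch b T * V S T).
  rewrite -(sum_coin_tails _ qp); apply: eq_bigr => c _; congr (_ * _).
  case: (sel c) => //; apply: big1 => S _; rewrite big1 ?mulr0 // => T _.
  by rewrite mulr0.
apply: ler_wpM2l; first by rewrite subr_ge0.
have VE S T : V S T = \sum_(k < d) (e k 0 + batch_dev b (fun i => a i k 0) S +
    batch_dev b (fun j => a' j k 0) T) ^+ 2.
  rewrite /V sqr_enormE; apply: eq_bigr => k _; congr (_ ^+ 2).
  rewrite !mxE !summxE /batch_dev; congr (_ + (_ - _) + (_ - _));
    by apply: eq_bigr => i _; rewrite mxE.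
have -> : \sum_S unif_batch b S * (\sum_T unif_batch b T * V S T) =
  \sum_(k < d) \sum_S unif_batch b S * (\sum_T unif_batch b T *
   (e k 0 + batch_dev b (fun i => a i k 0) S +
    batch_dev b (fun j => a' j k 0) T) ^+ 2).
  rewrite exchange_big; apply: eq_bigr => S _; rewrite -mulr_sumr; congr (_ * _).
  rewrite exchange_big; apply: eq_bigr => T _; rewrite -mulr_sumr; congr (_ * _).
  exact: VE.
apply: le_trans (ler_sum _ (fun k _ => mean_sqr_two_batches _ _ _)) _.
rewrite big_split /= -sqr_enormE lerD2l -mulr_sumr.
apply: ler_wpM2l; first by rewrite divr_ge0.
rewrite big_split /= -!mulr_sumr; apply: lerD.
  rewrite exchange_big /= mulrC ler_pdivrMr // mulrC -sumr_const_ord.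
  apply: ler_sum => i _.
  by rewrite -sqr_enormE.
rewrite exchange_big /= mulrC ler_pdivrMr // mulrC -sumr_const_ord.
apply: ler_sum => i _.
by rewrite -sqr_enormE.
Qed.

End OneSample.

Section DirectionError.
Context {R : realType} {dx dy : nat}.
Implicit Types (phi psi : 'cV[R]_(dx + dy) -> R) (w : Defs.point R dx dy).

(** [D] splits into a part linear in the upper-level function and a part linear in
    the lower-level one, sampled independently. *)
Definition DF phi w : Defs.point R dx dy :=
  let u := col_mx w.1.1 w.1.2 in
  (usubmx (grad phi u), 0, - dsubmx (grad phi u)).

Definition DG psi w : Defs.point R dx dy :=
  let u := col_mx w.1.1 w.1.2 in
  (- (ursubmx (hess psi u) *m w.2), dsubmx (grad psi u), drsubmx (hess psi u) *m w.2).

Lemma mulmx_diff d e (A A' : 'M[R]_(d, e)) (v v' : 'cV[R]_e) :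
  A *m v - A' *m v' = (A - A') *m v + A' *m (v - v').
Proof. by rewrite mulmxBl mulmxBr addrA subrK. Qed.

Lemma enorm_ursubmx_diff (H H' : 'M[R]_(dx + dy)) (z z' : 'cV[R]_dy) :
  enorm (- (ursubmx H *m z) - - (ursubmx H' *m z')) <=
  enorm (H *m col_mx 0 z - H' *m col_mx 0 z').
Proof. by rewrite !ursubmx_mul -opprD enormN -usubmxB enorm_usubmx. Qed.

Lemma enorm_drsubmx_diff (H H' : 'M[R]_(dx + dy)) (z z' : 'cV[R]_dy) :
  enorm (drsubmx H *m z - drsubmx H' *m z') <=
  enorm (H *m col_mx 0 z - H' *m col_mx 0 z').
Proof. by rewrite !drsubmx_mul -dsubmxB enorm_dsubmx. Qed.

Lemma wsumB d N (c : 'I_N -> R) (a a' : 'I_N -> 'cV[R]_d) :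
  wsum c (fun i => a i - a' i) = wsum c a - wsum c a'.
Proof. by rewrite /wsum -sumrB; apply: eq_bigr => i _; rewrite scalerBr. Qed.

Lemma D_wsum n m (c : 'I_n -> R) (c' : 'I_m -> R) F G w :
  (forall i u, differentiable (F i) u) -> (forall j u, differentiable (G j) u) ->
  (forall j u, differentiable (grad (G j)) u) ->
  D (fun u => \sum_i c i * F i u) (fun u => \sum_j c' j * G j u) w =
  (wsum c (fun i => (DF (F i) w).1.1) + wsum c' (fun j => (DG (G j) w).1.1),
   wsum c (fun i => (DF (F i) w).1.2) + wsum c' (fun j => (DG (G j) w).1.2),
   wsum c (fun i => (DF (F i) w).2) + wsum c' (fun j => (DG (G j) w).2)).
Proof.
move=> dF dG ddG; case: w => -[x y] z; rewrite /D /DF /DG /=; set u := col_mx x y.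
rewrite !grad_wsum // hess_wsum //.
have us k d e (X : 'I_k -> 'cV[R]_(d + e)) (t : 'I_k -> R) :
    usubmx (\sum_i t i *: X i) = wsum t (fun i => usubmx (X i)).
  by apply/matrixP => i j; rewrite /wsum !mxE !summxE; apply: eq_bigr => l _; rewrite !mxE.
have ds k d e (X : 'I_k -> 'cV[R]_(d + e)) (t : 'I_k -> R) :
    dsubmx (\sum_i t i *: X i) = wsum t (fun i => dsubmx (X i)).
  by apply/matrixP => i j; rewrite /wsum !mxE !summxE; apply: eq_bigr => l _; rewrite !mxE.
have wsumN k d (X : 'I_k -> 'cV[R]_d) (t : 'I_k -> R) :
    wsum t (fun i => - X i) = - wsum t X.
  by rewrite /wsum -sumrN; apply: eq_bigr => i _; rewrite scalerN.
have hz (X : 'I_m -> 'M[R]_(dx + dy)) : (\sum_i c' i *: X i) *m col_mx 0 z =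
    \sum_i c' i *: (X i *m col_mx 0 z).
  by rewrite mulmx_suml; apply: eq_bigr => i _; rewrite scalemxAl.
rewrite !ursubmx_mul !drsubmx_mul !hz !us !ds !wsumN; congr (_, _, _).
- congr (_ - _); rewrite /wsum; apply: eq_bigr => j _.
  by rewrite ursubmx_mul.
- rewrite -[LHS]add0r; congr (_ + _).
  by rewrite /wsum big1 // => i _; rewrite scaler0.
- rewrite [RHS]addrC; congr (_ - _); rewrite /wsum; apply: eq_bigr => j _.
  by rewrite drsubmx_mul.
Qed.

Section Lipschitz.
Variables (L : R).
Hypothesis L0 : 0 <= L.

Lemma sqr_norm_xy w w' :
  enorm (col_mx w.1.1 w.1.2 - col_mx w'.1.1 w'.1.2) ^+ 2 <= psqnorm (psub w w').
Proof. by rewrite col_mxB sqr_enorm_col_mx /psqnorm /= lerDl sqr_ge0. Qed.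

Lemma grad_lip_sqr phi w w' : lipschitz_grad L phi ->
  enorm (grad phi (col_mx w.1.1 w.1.2) - grad phi (col_mx w'.1.1 w'.1.2)) ^+ 2 <=
  L ^+ 2 * psqnorm (psub w w').
Proof.
move=> [_ lip]; apply: le_trans (sqr_enorm_le (lip _ _)) _.
by rewrite exprMn ler_wpM2l ?sqr_ge0 ?sqr_norm_xy.
Qed.

(** The product rule is arranged so that the variation of the Hessian multiplies
    the [z]-component that is known to be bounded; for the other endpoint the two
    points are exchanged. *)
Lemma hess_lip_sqr psi rho w w' : lipschitz_grad L psi -> lipschitz_hess L psi ->
  enorm w.2 <= rho \/ enorm w'.2 <= rho ->
  enorm (hess psi (col_mx w.1.1 w.1.2) *m col_mx 0 w.2 -
         hess psi (col_mx w'.1.1 w'.1.2) *m col_mx 0 w'.2) ^+ 2 <=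
  2 * L ^+ 2 * (1 + rho ^+ 2) * psqnorm (psub w w').
Proof.
move=> lg lh; wlog wr : w w' / enorm w.2 <= rho.
  move=> H [h|h]; first by apply: H => //; left.
  have pC : psqnorm (psub w w') = psqnorm (psub w' w).
    by rewrite /psqnorm /= !(enormB w.1.1, enormB w.1.2, enormB w.2).
  by rewrite enormB pC; apply: H => //; left.
move=> _; set u := col_mx w.1.1 _; set u' := col_mx w'.1.1 _.
have -> : hess psi u *m col_mx 0 w.2 - hess psi u' *m col_mx 0 w'.2 =
   (hess psi u - hess psi u') *m col_mx 0 w.2 + hess psi u' *m (col_mx 0 (w.2 - w'.2)).
  have -> : col_mx 0 (w.2 - w'.2) = col_mx 0 w.2 - col_mx 0 w'.2 :> 'cV[R]_(dx + dy).
    by rewrite col_mxB subrr.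
  exact: mulmx_diff.
apply: le_trans (sqr_enormD2 _ _) _.
have h1 := sqr_enorm_le (enorm_hessB lh u u' (col_mx 0 w.2)).
have h2 := sqr_enorm_le (enorm_hess L0 lh u' (col_mx 0 (w.2 - w'.2)) L0 lg).
rewrite enorm_col_0mx !exprMn in h1; rewrite enorm_col_0mx exprMn in h2.
have h3 : enorm (u - u') ^+ 2 = enorm (w.1.1 - w'.1.1) ^+ 2 + enorm (w.1.2 - w'.1.2) ^+ 2.
  by rewrite col_mxB sqr_enorm_col_mx.
have h4 := sqr_enorm_le wr.
have h5 : L ^+ 2 * enorm (u - u') ^+ 2 * enorm w.2 ^+ 2 <=
    L ^+ 2 * enorm (u - u') ^+ 2 * rho ^+ 2.
  by rewrite ler_wpM2l // mulr_ge0 ?sqr_ge0.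
have -> : psqnorm (psub w w') = enorm (u - u') ^+ 2 + enorm (w.2 - w'.2) ^+ 2.
  by rewrite h3.
have h6 : 0 <= L ^+ 2 * enorm (u - u') ^+ 2 by rewrite mulr_ge0 ?sqr_ge0.
have h7 := mulr_ge0 (mulr_ge0 (sqr_ge0 L) (sqr_ge0 rho)) (sqr_ge0 (enorm (w.2 - w'.2))).
lra.
Qed.

End Lipschitz.

Section NewDirection.
Context {n m : nat} (b : nat) (p L rho : R) (q : coins -> R).
Variables (F : 'I_n -> 'cV[R]_(dx + dy) -> R) (G : 'I_m -> 'cV[R]_(dx + dy) -> R).
Hypotheses (b0 : (0 < b)%N) (bn : (b <= n)%N) (bm : (b <= m)%N).
Hypotheses (p1 : p <= 1) (hq : coin_law p q) (L0 : 0 <= L).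
Hypotheses (lF : forall i, lipschitz_grad L (F i)).
Hypotheses (lG : forall j, lipschitz_grad L (G j)).
Hypotheses (lhG : forall j, lipschitz_hess L (G j)).

Let dF i u : differentiable (F i) u. Proof. by have [] := lF i. Qed.
Let dG j u : differentiable (G j) u. Proof. by have [] := lG j. Qed.
Let ddG j u : differentiable (grad (G j)) u. Proof. by have [] := lhG j. Qed.

Lemma batch_meanE d N (H : 'I_N -> 'cV[R]_d -> R) (S : {set 'I_N}) :
  batch_mean b H S = fun u => \sum_i batch_weight b S i * H i u.
Proof.
apply/funext => u; rewrite /batch_mean mulr_sumr big_mkcond /=.
by apply: eq_bigr => i _; rewrite /batch_weight; case: ifP => // _; rewrite mul0r.
Qed.

Lemma meanE d N (H : 'I_N -> 'cV[R]_d -> R) :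
  mean H = fun u => \sum_i N%:R^-1 * H i u.
Proof. by apply/funext => u; rewrite /mean mulr_sumr. Qed.

Lemma DF_lip_sqr phi w w' : lipschitz_grad L phi ->
  [/\ enorm ((DF phi w).1.1 - (DF phi w').1.1) ^+ 2 <= L ^+ 2 * psqnorm (psub w w'),
      enorm ((DF phi w).1.2 - (DF phi w').1.2) ^+ 2 <= L ^+ 2 * psqnorm (psub w w') &
      enorm ((DF phi w).2 - (DF phi w').2) ^+ 2 <= L ^+ 2 * psqnorm (psub w w')].
Proof.
move=> lphi; have h := grad_lip_sqr w w' lphi; split; rewrite /DF /=.
- by rewrite -usubmxB; apply: le_trans h; apply: sqr_enorm_le; exact: enorm_usubmx.
- by rewrite subrr enorm0 expr0n mulr_ge0 ?sqr_ge0 ?psqnorm_ge0.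
- rewrite -opprD enormN -dsubmxB; apply: le_trans h; apply: sqr_enorm_le.
  exact: enorm_dsubmx.
Qed.

Lemma DG_lip_sqr psi w w' : lipschitz_grad L psi -> lipschitz_hess L psi ->
  enorm w.2 <= rho \/ enorm w'.2 <= rho ->
  let B := 2 * L ^+ 2 * (1 + rho ^+ 2) * psqnorm (psub w w') in
  [/\ enorm ((DG psi w).1.1 - (DG psi w').1.1) ^+ 2 <= B,
      enorm ((DG psi w).1.2 - (DG psi w').1.2) ^+ 2 <= B &
      enorm ((DG psi w).2 - (DG psi w').2) ^+ 2 <= B].
Proof.
move=> lpsi lhpsi hrho B; have h := hess_lip_sqr L0 lpsi lhpsi hrho.
have h' := grad_lip_sqr w w' lpsi; split; rewrite /DG /=.
- by apply: le_trans h; apply: sqr_enorm_le; exact: enorm_ursubmx_diff.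
- rewrite -dsubmxB; apply: le_trans (sqr_enorm_le (enorm_dsubmx _)) _.
  apply: le_trans h' _; rewrite /B ler_wpM2r ?psqnorm_ge0 //.
  by have := sqr_ge0 L; have := mulr_ge0 (sqr_ge0 L) (sqr_ge0 rho); lra.
- by apply: le_trans h; apply: sqr_enorm_le; exact: enorm_drsubmx_diff.
Qed.

(** The recursion that distinguishes variance reduction from plain sampling: the
    old error is damped by [1 - p], and the fresh noise is proportional to the
    last displacement rather than to a variance at the current point. *)
Lemma direction_error_step (st : @state R dx dy) :
  enorm (cur st).2 <= rho \/ enorm (Defs.prev st).2 <= rho ->
  \sum_(s : @sample n m) sample_prob b q s *
    dir_sq (mean F) (mean G) (cur st) (new_dir F G b st s) <=
  (1 - p) * (dir_sq (mean F) (mean G) (Defs.prev st) (dir st) +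
    18 * L ^+ 2 * (1 + rho ^+ 2) / b%:R * psqnorm (psub (cur st) (Defs.prev st))).
Proof.
case: st => w0 w1 v /= hrho; set W := psqnorm (psub w1 w0).
have [_ [_ qx qy qz]] := hq.
pose A := L ^+ 2 * W; pose A' := 2 * L ^+ 2 * (1 + rho ^+ 2) * W.
have lFw i := DF_lip_sqr w1 w0 (lF i).
have lGw j := DG_lip_sqr (lG j) (lhG j) hrho.
have Fx i : enorm ((DF (F i) w1).1.1 - (DF (F i) w0).1.1) ^+ 2 <= A by have [] := lFw i.
have Fy i : enorm ((DF (F i) w1).1.2 - (DF (F i) w0).1.2) ^+ 2 <= A by have [] := lFw i.
have Fz i : enorm ((DF (F i) w1).2 - (DF (F i) w0).2) ^+ 2 <= A by have [] := lFw i.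
have Gx j : enorm ((DG (G j) w1).1.1 - (DG (G j) w0).1.1) ^+ 2 <= A' by have [] := lGw j.
have Gy j : enorm ((DG (G j) w1).1.2 - (DG (G j) w0).1.2) ^+ 2 <= A' by have [] := lGw j.
have Gz j : enorm ((DG (G j) w1).2 - (DG (G j) w0).2) ^+ 2 <= A' by have [] := lGw j.
have hx := mean_sqr_component b0 bn bm p1 hq (v.1.1 - (D (mean F) (mean G) w0).1.1) qx Fx Gx.
have hy := mean_sqr_component b0 bn bm p1 hq (v.1.2 - (D (mean F) (mean G) w0).1.2) qy Fy Gy.
have hz := mean_sqr_component b0 bn bm p1 hq (v.2 - (D (mean F) (mean G) w0).2) qz Fz Gz.
have vr d (s a a' t t' c c' e e' : 'cV[R]_d) :
    s - (a' + t') + (c - c' - (a - a')) + (e - e' - (t - t')) =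
    s + (c + e - (c' + e')) - (a + t).
  by vring.
apply: (le_trans (le_trans _ (lerD (lerD hx hy) hz))); last first.
  rewrite dir_sq_split /= -!mulrDr; apply: ler_wpM2l; first by rewrite subr_ge0.
  have AA : A + A' <= 3 * L ^+ 2 * (1 + rho ^+ 2) * W.
    rewrite /A /A' -mulrDl ler_wpM2r ?psqnorm_ge0 //.
    by have := sqr_ge0 L; have := mulr_ge0 (sqr_ge0 L) (sqr_ge0 rho); lra.
  have : 2 / b%:R * (A + A') <= 2 / b%:R * (3 * L ^+ 2 * (1 + rho ^+ 2) * W).
    by rewrite ler_wpM2l // divr_ge0.
  by move: (b%:R^-1) => bi; lra.
rewrite -!big_split /=; apply: ler_sum => -[[c S] T] _ /=.
rewrite -!mulrDr; apply: ler_wpM2l; first exact: sample_prob_ge0 hq _.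
rewrite dir_sq_split /= !batch_meanE !meanE !D_wsum //=.
rewrite !wsumB !vr le_eqVlt; apply/orP; left; apply/eqP.
by congr (_ + _ + _); case: ifP => // _; rewrite subrr enorm0 expr0n.
Qed.

End NewDirection.

End DirectionError.

(** * Averages over runs *)

Section RunMean.
Context {R : realType} {n m : nat} (K b : nat) (p : R) (q : coins -> R).
Hypotheses (bn : (b <= n)%N) (bm : (b <= m)%N) (hq : coin_law p q).

Local Notation sample := (@sample n m).
Local Notation pr := (sample_prob b q).
Local Notation rmean := (@run_mean R n m K b q).
Implicit Types (X Y : (nat -> sample) -> R).

Let pr0 (s : sample) : 0 <= pr s. Proof. exact: sample_prob_ge0 hq s. Qed.

Lemma run_mean_le X Y : (forall w, X w <= Y w) -> rmean X <= rmean Y.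
Proof.
move=> XY; apply: ler_sum => w _; apply: ler_wpM2l => //.
by apply: prodr_ge0 => k _.
Qed.

Lemma eq_run_mean X Y : (forall w, X w = Y w) -> rmean X = rmean Y.
Proof. by move=> XY; apply: eq_bigr => w _; rewrite XY. Qed.

Lemma run_meanD X Y : rmean (fun w => X w + Y w) = rmean X + rmean Y.
Proof. by rewrite /run_mean -big_split; apply: eq_bigr => w _; rewrite mulrDr. Qed.

Lemma run_meanZ a X : rmean (fun w => a * X w) = a * rmean X.
Proof. by rewrite /run_mean mulr_sumr; apply: eq_bigr => w _; rewrite mulrCA. Qed.

Lemma run_mean_sum (X : nat -> (nat -> sample) -> R) N :
  rmean (fun w => \sum_(k < N) X k w) = \sum_(k < N) rmean (X k).
Proof.
rewrite /run_mean exchange_big; apply: eq_bigr => w _.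
by rewrite mulr_sumr.
Qed.

Lemma run_mean_cst a : rmean (fun=> a) = a.
Proof.
rewrite /run_mean -mulr_suml (reindex (fun f : {ffun 'I_K -> sample} => mktuple f)).
  under eq_bigr => f _ do under eq_bigr => k _ do rewrite tnth_mktuple.
  rewrite -(bigA_distr_bigA (fun _ : 'I_K => pr)) big1 ?mul1r // => k _.
  exact: sum_sample_prob bn bm hq.
exists (fun t : K.-tuple sample => [ffun k => tnth t k]) => [f _|t _].
  by apply/ffunP => k; rewrite ffunE tnth_mktuple.
by apply: eq_from_tnth => k; rewrite tnth_mktuple ffunE.
Qed.

Lemma run_mean_ge0 X : (forall w, 0 <= X w) -> 0 <= rmean X.
Proof. by move=> X0; rewrite -(run_mean_cst 0); exact: run_mean_le. Qed.

Definition resample k (w : nat -> sample) (s : sample) : nat -> sample :=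
  fun i => if i == k then s else w i.

(** Exchanging the sample of iteration [k] with a fresh independent one preserves
    the joint law; this stands for conditioning on the other iterations. *)
Lemma run_mean_resample X k : (k < K)%N ->
  rmean X = rmean (fun w => \sum_s pr s * X (resample k w s)).
Proof.
move=> kK; pose k0 := Ordinal kK.
pose w0 : sample := ((false, false, false), finset.set0, finset.set0).
pose upd (w : K.-tuple sample) s := [tuple if i == k0 then s else tnth w i | i < K].
pose pw (w : K.-tuple sample) := \prod_(i < K) pr (tnth w i).
have updE w s : nth w0 (upd w s) = resample k (nth w0 w) s.
  apply/funext => i; rewrite /resample; have [iK|Ki] := ltnP i K; last first.
    by rewrite !nth_default ?size_tuple // gtn_eqF // (leq_trans kK).
  have := tnth_nth w0 (upd w s) (Ordinal iK); rewrite /= => <-.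
  have := tnth_nth w0 w (Ordinal iK); rewrite /= => <-.
  by rewrite tnth_mktuple.
have pwE w : pw w = pr (tnth w k0) * \prod_(i < K | i != k0) pr (tnth w i).
  by rewrite /pw (bigD1 k0).
pose phi (ws : K.-tuple sample * sample) := (upd ws.1 ws.2, tnth ws.1 k0).
have phiK : involutive phi.
  move=> [w s]; rewrite /phi /=; congr (_, _); last by rewrite tnth_mktuple eqxx.
  apply: eq_from_tnth => i; rewrite !tnth_mktuple.
  by case: eqP => // ->.
transitivity (\sum_(ws : K.-tuple sample * sample) pw ws.1 * (pr ws.2 * X (nth w0 ws.1))).
  rewrite -(pair_bigA _ (fun w s => pw w * (pr s * X (nth w0 w)))) /=.
  apply: eq_bigr => w _; rewrite -mulr_sumr -mulr_suml.
  by rewrite (sum_sample_prob bn bm hq) mul1r.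
rewrite (reindex_inj (inv_inj phiK)).
transitivity (\sum_(ws : K.-tuple sample * sample)
    pw ws.1 * (pr ws.2 * X (resample k (nth w0 ws.1) ws.2))); last first.
  rewrite -(pair_bigA _ (fun w s => pw w * (pr s * X (resample k (nth w0 w) s)))) /=.
  by apply: eq_bigr => w _; rewrite -mulr_sumr.
apply: eq_bigr => -[w s] _; rewrite /phi /= updE 2!(mulrA (pw _)); congr (_ * _).
rewrite !pwE tnth_mktuple eqxx.
rewrite [X in pr s * X * _](_ : _ = \prod_(i < K | i != k0) pr (tnth w i)); last first.
  by apply: eq_bigr => i ik; rewrite tnth_mktuple (negbTE ik).
by move: (pr _) (pr _) => t t'; ring.
Qed.

End RunMean.

Section Runs.
Context {R : realType} {dx dy n m : nat}.
Variables (F : 'I_n -> 'cV[R]_(dx + dy) -> R) (G : 'I_m -> 'cV[R]_(dx + dy) -> R).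
Variables (b : nat) (r : R) (alpha beta gamma : nat -> R) (st0 : @state R dx dy).

Local Notation run := (run F G b r alpha beta gamma st0).

Lemma run_resample_past j k w s : (j <= k)%N -> run (resample k w s) j = run w j.
Proof.
elim: j => [//|j IH] jk /=.
by rewrite IH 1?ltnW // /resample ltn_eqF.
Qed.

Lemma run_resample k w s : run (resample k w s) k.+1 =
  step F G b r alpha beta gamma k (run w k) s.
Proof. by rewrite /= run_resample_past // /resample eqxx. Qed.

Lemma run_prev w k : Defs.prev (run w k.+1) = cur (run w k).
Proof. by rewrite /= /step; case: (cur (run w k)) => -[x y] z. Qed.

Lemma step_prev k st s : Defs.prev (step F G b r alpha beta gamma k st s) = cur st.
Proof. by rewrite /step; case: (cur st) => -[x y] z. Qed.

Lemma step_dir k st s :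
  dir (step F G b r alpha beta gamma k st s) = new_dir F G b st s.
Proof. by rewrite /step; case: (cur st) => -[x y] z. Qed.

Lemma run_cur w k : cur (run w k.+1) =
  advance r (alpha k) (beta k) (gamma k) (cur (run w k)) (dir (run w k.+1)).
Proof. by rewrite /= /step /advance; case: (cur (run w k)) => -[x y] z. Qed.

End Runs.

(** * The potential argument *)

Lemma total_sq_ge0 {R : realType} {dx dy : nat} (f g : 'cV[R]_(dx + dy) -> R) w v :
  0 <= total_sq f g w v.
Proof.
exact: (addr_ge0 (addr_ge0 (addr_ge0 (grad_sq_ge0 f g w) (y_sq_ge0 g w))
  (z_sq_ge0 f g w)) (dir_sq_ge0 f g w v)).
Qed.

Section Potential.
Context {R : realType} {dx dy : nat} (L mu r : R) (f g : 'cV[R]_(dx + dy) -> R).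
Hypothesis P : bilevel_problem L mu r f g.
Variables (cb cg : R).
Let q := L * (1 + r).
Let kappa := L / mu.
Let nu := q * (1 + L / mu) / mu.
Hypotheses (cb0 : 0 < cb) (cg0 : 0 < cg).
Hypotheses (cb_drift : 320 * q ^+ 2 * kappa ^+ 2 <= mu * cb)
  (cg_drift : 320 * q ^+ 2 * nu ^+ 2 <= mu * cg)
  (cg_big : 8 * q ^+ 2 + 5 <= mu * cg)
  (cb_big : 8 * q ^+ 2 + 5 + 32 * cg / mu * q ^+ 2 <= mu * cb).

Definition potential (w : Defs.point R dx dy) : R :=
  hyper f g w.1.1 + y_sq g w + z_sq f g w.

(** The coefficient with which the direction error enters the decrease of the
    potential: the descent of [H] (1), the two drifts (1/8 each), and the
    perturbations of the contractions of [y] and [z]. *)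
Definition error_gain : R := 5 / 4 + 4 * cb / mu + 8 * cg / mu.

Let mu0 : 0 < mu. Proof. exact: mu_gt0 P. Qed.

(** The drift of the target is quadratic in the step size and is divided by a
    contraction rate linear in it, so it is a small multiple of [a * T] once the
    ratio [cc] of the step sizes is large. *)
Lemma drift_le (a cc k V T : R) : 0 < a -> 0 < cc -> 0 <= T ->
  320 * q ^+ 2 * k ^+ 2 <= mu * cc -> V <= 8 * q ^+ 2 * T ->
  5 / (cc * a * mu) * (k ^+ 2 * (a ^+ 2 * V)) <= a / 8 * T.
Proof.
move=> a0 cc0 T0 hk hV.
have -> : 5 / (cc * a * mu) * (k ^+ 2 * (a ^+ 2 * V)) = 5 * k ^+ 2 * a * V / (cc * mu).
  by field; rewrite !gt_eqF.
rewrite ler_pdivrMr ?mulr_gt0 //.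
have h1 : 5 * k ^+ 2 * a * V <= 5 * k ^+ 2 * a * (8 * q ^+ 2 * T).
  by apply: ler_wpM2l => //; apply: mulr_ge0; [apply: mulr_ge0 => //; exact: sqr_ge0|exact: ltW].
apply: le_trans h1 _.
have : a * T * (320 * q ^+ 2 * k ^+ 2) <= a * T * (mu * cc).
  by apply: ler_wpM2l => //; apply: mulr_ge0 => //; exact: ltW.
move: (q ^+ 2) (k ^+ 2) => q2 k2; lra.
Qed.

Lemma potential_step (a : R) w v : 0 < a ->
  a * (q * (1 + kappa ^+ 2)) <= 1 / 2 -> cb * a * L ^+ 2 <= mu ->
  cg * a * L ^+ 2 <= mu ->
  potential (advance r a (cb * a) (cg * a) w v) +
    a * (grad_sq f g w / 4 + y_sq g w + z_sq f g w) <=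
  potential w + error_gain * (a * dir_sq f g w v).
Proof.
move=> a0 aM aby agz.
have T0 : 0 <= total_sq f g w v.
  exact: total_sq_ge0.
have H := hyper_descent P w v (ltW a0) aM.
have hY := y_step P a (cg * a) w v (mulr_gt0 cb0 a0) aby.
have hZ := z_step P a (cb * a) w v (mulr_gt0 cg0 a0) agz.
have dY := drift_le a0 cb0 T0 cb_drift (vx_bound P w v).
have dZ := drift_le a0 cg0 T0 cg_drift (vx_bound P w v).
have {}hY := le_trans hY (lerD (lexx _) dY).
have {}hZ := le_trans hZ (lerD (lexx _) dZ).
rewrite /potential; move: (y_sq g (advance _ _ _ _ _ _)) hY => Y' hY.
move: (z_sq f g (advance _ _ _ _ _ _)) hZ => Z' hZ.
rewrite /advance /= -/q in H hY hZ *.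
move: (hyper f g _) H => H' H.
have Y0 := y_sq_ge0 g w; have Z0 := z_sq_ge0 f g w; move: H hY hZ; rewrite /total_sq.
move: (dir_sq_ge0 f g w v) Y0 Z0 (grad_sq_ge0 f g w).
move: (hyper f g _) (grad_sq f g w) (y_sq g w) (z_sq f g w) (dir_sq f g w v).
move=> H0 G Y Z S S0 Y0 Z0 G0 hH hY hZ.
have eY := ler_wpM2l (mulr_ge0 (ltW a0) Y0) cb_big.
have eZ := ler_wpM2l (mulr_ge0 (ltW a0) Z0) cg_big.
have aG := mulr_ge0 (ltW a0) G0.
rewrite /error_gain.
have E1 : 4 * (cb * a) / mu * S = 4 * (cb / mu) * a * S by ring.
have E2 : 4 * (cg * a) / mu * (2 * S + 2 * q ^+ 2 * Y) =
  8 * (cg / mu) * a * S + 8 * (cg / mu) * q ^+ 2 * a * Y by ring.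
have E3 : a * Y * (8 * q ^+ 2 + 5 + 32 * cg / mu * q ^+ 2) =
  8 * q ^+ 2 * a * Y + 5 * a * Y + 32 * (cg / mu) * q ^+ 2 * a * Y by ring.
have E4 : (5 / 4 + 4 * cb / mu + 8 * cg / mu) * (a * S) =
  5 / 4 * a * S + 4 * (cb / mu) * a * S + 8 * (cg / mu) * a * S by ring.
rewrite E1 in hY; rewrite E2 in hZ; rewrite E3 in eY; rewrite E4.
clear - hH hY hZ eY eZ aG.
move: (cb / mu) (cg / mu) (q ^+ 2) hH hY hZ eY eZ => t s u hH hY hZ eY eZ; lra.
Qed.

End Potential.

(** Solving the error recursion: an error survives [(1 - p) / p] iterations on
    average. *)
Lemma sum_damped_errors {R : realType} K (p : R) (s d : nat -> R) :
  0 < p -> p <= 1 -> (forall k, 0 <= s k) ->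
  (forall k, (k < K)%N -> s k.+1 <= (1 - p) * (s k + d k)) ->
  \sum_(k < K) s k.+1 <= (1 - p) / p * (s 0 + \sum_(k < K) d k).
Proof.
move=> p0 p1 s0 h.
have h1 : \sum_(k < K) s k.+1 <= (1 - p) * (\sum_(k < K) s k + \sum_(k < K) d k).
  by rewrite -big_split mulr_sumr; apply: ler_sum => k _; exact: h.
have h2 : \sum_(k < K) s k <= s 0 + \sum_(k < K) s k.+1.
  have <- : \sum_(k < K.+1) s k = s 0 + \sum_(k < K) s k.+1 by rewrite big_ord_recl.
  by rewrite big_ord_recr lerDl.
rewrite mulrAC ler_pdivlMr //.
have : (1 - p) * \sum_(k < K) s k <= (1 - p) * (s 0 + \sum_(k < K) s k.+1).
  by apply: ler_wpM2l => //; rewrite subr_ge0.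
move: h1; move: (\sum_(k < K) s k.+1) (\sum_(k < K) s k) (\sum_(k < K) d k) => A B C; lra.
Qed.

(** The two coupled inequalities close because the feedback coefficient [e],
    quadratic in the step size, is small. *)
Lemma close_feedback {R : realType} (U Q Psi X C e : R) :
  0 <= U -> 0 <= Q -> 0 <= Psi -> 0 <= X -> 1 <= C -> 16 * C * e <= 1 ->
  U <= Psi + C * Q -> Q <= X + e * (4 * U + Q) ->
  U <= 2 * Psi + 2 * (C * X).
Proof.
move=> U0 Q0 Psi0 X0 C1 Ce hU hQ.
have h1 : C * Q <= C * (X + e * (4 * U + Q)) by apply: ler_wpM2l => //; lra.
have h2 : 16 * C * e * (4 * U + Q) <= 1 * (4 * U + Q) by apply: ler_wpM2r => //; lra.
have h3 : Q <= C * Q by rewrite ler_peMl.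
have h4 : 0 <= C * X by apply: mulr_ge0 => //; lra.
move: h1 h2 h3 h4 hU; rewrite mulrDr; move: (C * Q) (C * X) => t x; lra.
Qed.

Lemma rate_ge1 {R : realType} (p : R) b : 1 <= rate p b.
Proof. by rewrite lerDl sqrtr_ge0. Qed.

Lemma rate_sqr {R : realType} (p : R) b : 0 < p -> p <= 1 -> (0 < b)%N ->
  (1 - p) / p / b%:R <= rate p b ^+ 2.
Proof.
move=> p0 p1 b0; have bR : 0 < b%:R :> R by rewrite ltr0n.
have t0 : 0 <= (1 - p) / (p * b%:R).
  by rewrite divr_ge0 ?subr_ge0 // mulr_ge0 // ltW.
rewrite -mulrA -invfM -[X in X <= _](sqr_sqrtr t0) /rate.
have := sqrtr_ge0 ((1 - p) / (p * b%:R)).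
by move: (Num.sqrt _) => t t0'; rewrite sqrrD; lra.
Qed.

(** * The convergence rate *)

Lemma telescope_step {R : realType} (V0 V V' s a C t e : R) :
  V' + a <= V + C * e -> V + s <= V0 + C * t -> V' + (s + a) <= V0 + C * (t + e).
Proof. by move=> h1 h2; rewrite mulrDr; lra. Qed.

Lemma potential_gap {R : realType} {dx dy : nat} (L mu r B : R)
    (f g : 'cV[R]_(dx + dy) -> R) (st0 : @state R dx dy) w :
  bilevel_problem L mu r f g -> initial_gap f g st0 B ->
  potential f g (cur st0) <= potential f g w + (B + B ^+ 2 + (B + r) ^+ 2).
Proof.
move=> P; rewrite /initial_gap; case: (cur st0) => -[x y] z [h1 h2 h3].
have hy : y_sq g (x, y, z) <= B ^+ 2 by exact: sqr_enorm_le.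
have hz : z_sq f g (x, y, z) <= (B + r) ^+ 2.
  apply: sqr_enorm_le; apply: le_trans (ler_enormB _ _) _; apply: lerD => //.
  exact: enorm_zstar P x.
have arith (s s' t t' v v' b b' : R) : s - s' <= B -> t <= b -> v <= b' ->
    0 <= t' -> 0 <= v' -> s + t + v <= s' + t' + v' + (B + b + b') by lra.
exact: arith (h1 _) hy hz (y_sq_ge0 _ _) (z_sq_ge0 _ _ _).
Qed.

(** Here [kp] is [(1 - p) / p], [bi] is [1 / b] and [am * rt = c] bounds the step
    sizes: one factor [am] compensates the initial data, of order [rt], and the two
    factors [am] of the displacements compensate [kp * bi <= rt ^+ 2]. *)
Lemma error_budget {R : realType} (kp bi S0 W0 z N0 N M am rt c B S WW T X : R) :
  0 <= kp -> 0 <= bi -> 0 <= S0 -> 0 <= W0 -> 0 <= z -> 0 <= N0 -> 0 <= N ->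
  0 <= M -> 0 <= am -> 0 <= X -> am * rt = c -> kp * bi <= rt ^+ 2 ->
  kp * (S0 + (W0 + z) * bi) <= B * rt -> S <= kp * (S0 + WW) ->
  WW <= (N0 * W0 + N * (8 * z)) * bi + N * M * am * bi * T -> T <= X ->
  am * S <= c * ((1 + N0 + 8 * N) * B) + c ^+ 2 * (N * M) * X.
Proof.
move=> kp0 bi0 S00 W00 z0 N00 N10 M0 am0 X0 <- kb init hS hW hT.
have NMa : 0 <= N * M * am * bi by rewrite !mulr_ge0.
have {}hW : WW <= (N0 * W0 + N * (8 * z)) * bi + N * M * am * bi * X.
  by apply: le_trans hW _; rewrite lerD2l ler_wpM2l.
have h1 : S0 + (N0 * W0 + N * (8 * z)) * bi <=
    (1 + N0 + 8 * N) * (S0 + (W0 + z) * bi).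
  have := mulr_ge0 N00 S00; have := mulr_ge0 N10 S00.
  have := mulr_ge0 W00 bi0; have := mulr_ge0 z0 bi0.
  have := mulr_ge0 N00 (mulr_ge0 z0 bi0); have := mulr_ge0 N10 (mulr_ge0 W00 bi0).
  lra.
have c0 : 0 <= 1 + N0 + 8 * N by lra.
have h2 : kp * (S0 + WW) <=
    (1 + N0 + 8 * N) * (B * rt) + N * M * am * X * (kp * bi).
  apply: le_trans (ler_wpM2l kp0 (lerD (lexx S0) hW)) _.
  have := ler_wpM2l kp0 h1; have := ler_wpM2l c0 init; lra.
have h3 : N * M * am * X * (kp * bi) <= N * M * am * X * rt ^+ 2.
  by rewrite ler_wpM2l // !mulr_ge0.
apply: le_trans (ler_wpM2l am0 (le_trans hS (le_trans h2 (lerD (lexx _) h3)))) _.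
by rewrite le_eqVlt; apply/orP; left; apply/eqP; ring.
Qed.

(** The squared Lipschitz constant of the sampled directions in the variance
    estimate, for [z]-components bounded by [rho]; 18 collects the three
    components, the two batches and the squares of sums. *)
Definition noise {R : realType} (L rho : R) : R := 18 * L ^+ 2 * (1 + rho ^+ 2).

(** The factor between the squared displacement and [a ^+ 2 * total_sq]. *)
Definition speed {R : realType} (cb cg q : R) : R :=
  (1 + cb ^+ 2 + 2 * cg ^+ 2) * (8 * q ^+ 2).

Lemma noise_ge0 {R : realType} (L rho : R) : 0 <= noise L rho.
Proof.
apply: mulr_ge0; last by apply: addr_ge0 => //; exact: sqr_ge0.
by apply: mulr_ge0 => //; exact: sqr_ge0.
Qed.

Lemma speed_ge0 {R : realType} (cb cg q : R) : 0 <= speed cb cg q.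
Proof.
apply: mulr_ge0; last by apply: mulr_ge0 => //; exact: sqr_ge0.
by have := sqr_ge0 cb; have := sqr_ge0 cg; lra.
Qed.

Section Convergence.
Context {R : realType} {dx dy n m : nat} (L mu r : R).
Variables (F : 'I_n -> 'cV[R]_(dx + dy) -> R) (G : 'I_m -> 'cV[R]_(dx + dy) -> R).
Let f := mean F.
Let g := mean G.
Hypothesis P : bilevel_problem L mu r f g.
Hypotheses (lF : forall i, lipschitz_grad L (F i)).
Hypotheses (lG : forall j, lipschitz_grad L (G j)).
Hypotheses (lhG : forall j, lipschitz_hess L (G j)).
Variables (cb cg : R).
Let q := L * (1 + r).
Let kappa := L / mu.
Let nu := q * (1 + L / mu) / mu.
Hypotheses (cb0 : 0 < cb) (cg0 : 0 < cg).
Hypotheses (cb_drift : 320 * q ^+ 2 * kappa ^+ 2 <= mu * cb)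
  (cg_drift : 320 * q ^+ 2 * nu ^+ 2 <= mu * cg)
  (cg_big : 8 * q ^+ 2 + 5 <= mu * cg)
  (cb_big : 8 * q ^+ 2 + 5 + 32 * cg / mu * q ^+ 2 <= mu * cb).

Variables (K b : nat) (p : R) (qc : coins -> R) (alpha beta gamma : nat -> R).
Variables (st0 : @state R dx dy) (c B : R).
Hypotheses (b0 : (0 < b)%N) (bn : (b <= n)%N) (bm : (b <= m)%N).
Hypotheses (p0 : 0 < p) (p1 : p <= 1) (hq : coin_law p qc).

Hypotheses (c0 : 0 < c)
  (c_descent : c * (q * (1 + kappa ^+ 2)) <= 1 / 2)
  (c_beta : cb * c * L ^+ 2 <= mu) (c_gamma : cg * c * L ^+ 2 <= mu)
  (c_feedback : 16 * error_gain mu cb cg * (c ^+ 2 * (noise L r * speed cb cg q)) <= 1).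
Hypotheses (gap : initial_gap f g st0 B)
  (init : initial_error f g r st0 p b <= B * rate p b).

Let a_max := c / rate p b.
Hypotheses (alpha_gt0 : forall k, (k < K)%N -> 0 < alpha k)
  (alpha_le : forall k, (k < K)%N -> alpha k <= a_max)
  (betaE : forall k, (k < K)%N -> beta k = cb * alpha k)
  (gammaE : forall k, (k < K)%N -> gamma k = cg * alpha k).

Local Notation run := (Defs.run F G b r alpha beta gamma st0).
Local Notation rmean := (@run_mean R n m K b qc).
Local Notation sample := (@sample n m).
Implicit Types (w : nat -> sample) (k : nat).

Let L0 : 0 <= L. Proof. exact: le_trans ler01 (ge1_L P). Qed.
Let mu0 : 0 < mu. Proof. exact: mu_gt0 P. Qed.
Let r0 : 0 <= r. Proof. exact: r_ge0 P. Qed.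
Let rate0 : 0 < rate p b. Proof. exact: lt_le_trans ltr01 (rate_ge1 p b). Qed.
Let bR : 0 < b%:R :> R. Proof. by rewrite ltr0n. Qed.

Let mean_le := @run_mean_le R n m K b p qc hq.
Let mean_cst := @run_mean_cst R n m K b p qc bn bm hq.

Let err k w := dir_sq f g (Defs.prev (run w k)) (dir (run w k)).
Let move_sq k w := psqnorm (psub (cur (run w k)) (Defs.prev (run w k))).
Let grads k w := grad_sq f g (cur (run w k)).
(* One fourth of the squared gradient is what the potential step keeps after
   paying for the two drifts. *)
Let gains k w := grads k w / 4 + y_sq g (cur (run w k)) + z_sq f g (cur (run w k)).
Let total k w := total_sq f g (cur (run w k)) (dir (run w k.+1)).
Let zeta := enorm ((cur st0).2 - proj_ball r (cur st0).2) ^+ 2.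
Let gain := error_gain mu cb cg.
Let Lam0 := noise L B.
Let Lam := noise L r.
Let M := speed cb cg q.
Let Psi := B + B ^+ 2 + (B + r) ^+ 2.

Let B0 : 0 <= B.
Proof.
move: gap; rewrite /initial_gap; case: (cur st0) => -[x y] z [_ _ zB].
exact: le_trans (enorm_ge0 z) zB.
Qed.

Let a_max_ge0 : 0 <= a_max. Proof. by rewrite divr_ge0 // ltW. Qed.

Let a_max_le : a_max <= c.
Proof. by rewrite ler_pdivrMr // ler_peMr ?(ltW c0) // rate_ge1. Qed.

Let M0 : 0 <= M. Proof. exact: speed_ge0. Qed.

Let gain1 : 1 <= gain.
Proof.
have h1 : 0 <= 4 * cb / mu by apply: divr_ge0; [apply: mulr_ge0 => //; exact: ltW|exact: ltW].
have h2 : 0 <= 8 * cg / mu by apply: divr_ge0; [apply: mulr_ge0 => //; exact: ltW|exact: ltW].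
by rewrite /gain /error_gain; lra.
Qed.

Let err_ge0 k w : 0 <= err k w. Proof. exact: dir_sq_ge0. Qed.
Let total_ge0 k w : 0 <= total k w. Proof. exact: total_sq_ge0. Qed.
Let move_ge0 k w : 0 <= move_sq k w. Proof. exact: psqnorm_ge0. Qed.
Let grads_ge0 k w : 0 <= grads k w. Proof. exact: grad_sq_ge0. Qed.
Let gains_ge k w : grads k w / 4 <= gains k w.
Proof. by rewrite /gains -addrA lerDl addr_ge0 ?y_sq_ge0 ?z_sq_ge0. Qed.

Let totalE k w : total k w <= 4 * gains k w + err k.+1 w.
Proof.
rewrite /total /gains /grads /err run_prev /total_sq.
have := y_sq_ge0 g (cur (run w k)); have := z_sq_ge0 f g (cur (run w k)).
move: (grad_sq _ _ _) (y_sq _ _) (z_sq _ _ _) (dir_sq _ _ _ _) => s t u v; lra.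
Qed.

Let potential_decrease w N : (N <= K)%N ->
  potential f g (cur (run w N)) + \sum_(k < N) alpha k * gains k w <=
  potential f g (cur st0) + gain * \sum_(k < N) alpha k * err k.+1 w.
Proof.
elim: N => [_|N IH NK]; first by rewrite !big_ord0 mulr0 !addr0.
rewrite !big_ord_recr /= run_cur betaE // gammaE //.
have a0 := alpha_gt0 NK; have ac := le_trans (alpha_le NK) a_max_le.
have q0 : 0 <= q by apply: mulr_ge0 => //; apply: addr_ge0.
have h1 : alpha N * (q * (1 + kappa ^+ 2)) <= 1 / 2.
  apply: le_trans c_descent; apply: ler_wpM2r => //; apply: mulr_ge0 => //.
  by apply: addr_ge0 => //; exact: sqr_ge0.
have h2 : cb * alpha N * L ^+ 2 <= mu.
  apply: le_trans c_beta; apply: ler_wpM2r; first exact: sqr_ge0.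
  by apply: ler_wpM2l => //; exact: ltW.
have h3 : cg * alpha N * L ^+ 2 <= mu.
  apply: le_trans c_gamma; apply: ler_wpM2r; first exact: sqr_ge0.
  by apply: ler_wpM2l => //; exact: ltW.
have h4 := potential_step P cb0 cg0 cb_drift cg_drift cg_big cb_big
  (cur (run w N)) (dir (run w N.+1)) a0 h1 h2 h3.
have E : dir_sq f g (cur (run w N)) (dir (run w N.+1)) = err N.+1 w.
  by rewrite /err run_prev.
rewrite E in h4; exact: telescope_step h4 (IH (ltnW NK)).
Qed.

Let sum_gains w : \sum_(k < K) alpha k * gains k w <=
  Psi + gain * (a_max * \sum_(k < K) err k.+1 w).
Proof.
have h : \sum_(k < K) alpha k * err k.+1 w <= a_max * \sum_(k < K) err k.+1 w.
  rewrite mulr_sumr; apply: ler_sum => k _; apply: ler_wpM2r => //.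
  by apply: alpha_le.
have {}h := ler_wpM2l (le_trans ler01 gain1) h.
have arith (V V' s t t' : R) : V' + s <= V + t -> t <= t' -> V <= V' + Psi ->
    s <= Psi + t' by lra.
exact: arith (potential_decrease w (leqnn K)) h (potential_gap _ P gap).
Qed.

Let z_in_ball w k : (0 < k)%N -> enorm (cur (run w k)).2 <= r.
Proof. by case: k => // k _; rewrite run_cur; exact: (proj1 (proj_ball_min _ r0)). Qed.

(* The last term appears at the first iteration only, where the initial z may lie
   outside the ball. *)
Let step_move w k : (k < K)%N ->
  move_sq k.+1 w <= M * (a_max * (alpha k * total k w)) +
    (if k == 0%N then 8 * zeta else 0).
Proof.
move=> kK; rewrite /move_sq run_prev run_cur betaE // gammaE //.
apply: le_trans (movement P _ _ _ _ _) _; apply: lerD.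
  rewrite -/(total k w) -/q.
  have -> : (alpha k ^+ 2 + (cb * alpha k) ^+ 2 + 2 * (cg * alpha k) ^+ 2) *
      (8 * q ^+ 2 * total k w) = M * (alpha k * (alpha k * total k w)).
    by rewrite /M /speed; ring.
  apply: ler_wpM2l => //; apply: ler_wpM2r; last exact: alpha_le.
  by apply: mulr_ge0 => //; apply: ltW; exact: alpha_gt0.
case: k kK => [|k] _ //=.
set z := (cur _).2; have zr : enorm z <= r := z_in_ball w (ltn0Sn k).
have := proj_ball_nonexp z r0 zr; rewrite subrr enorm0 => h.
rewrite enormB (_ : enorm _ = 0) ?expr0n ?mulr0 //.
by apply/eqP; rewrite eq_le h enorm_ge0.
Qed.

Let noise_k k := if k == 0%N then Lam0 else Lam.

Let sum_moves w : \sum_(k < K) noise_k k / b%:R * move_sq k w <=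
  (Lam0 * psqnorm (psub (cur st0) (Defs.prev st0)) + Lam * (8 * zeta)) / b%:R +
  Lam * M * a_max / b%:R * \sum_(k < K) alpha k * total k w.
Proof.
have z0 : 0 <= zeta by exact: sqr_ge0.
have -> : \sum_(k < K) noise_k k / b%:R * move_sq k w =
    (\sum_(k < K) noise_k k * move_sq k w) / b%:R.
  by rewrite mulr_suml; apply: eq_bigr => k _; rewrite mulrAC.
rewrite [_ / b%:R * _]mulrAC -mulrDl; apply: ler_wpM2r; first by rewrite invr_ge0 ltW.
have at0 k : (k < K)%N -> 0 <= alpha k * total k w.
  by move=> kK; apply: mulr_ge0 => //; apply: ltW; exact: alpha_gt0.
case: K alpha_le alpha_gt0 step_move at0 => [|N] _ _ sm at0.
  rewrite !big_ord0 mulr0 addr0; apply: addr_ge0.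
    by apply: mulr_ge0; [exact: noise_ge0|exact: psqnorm_ge0].
  by apply: mulr_ge0; [exact: noise_ge0|apply: mulr_ge0].
rewrite big_ord_recl /= -addrA lerD2l.
apply: le_trans (_ : \sum_(k < N) Lam * (M * (a_max * (alpha k * total k w)) +
    (if (k : nat) == 0%N then 8 * zeta else 0)) <= _).
  apply: ler_sum => k _; rewrite /noise_k /=; apply: ler_wpM2l; first exact: noise_ge0.
  by apply: sm; rewrite ltnS ltnW.
have E (t X : R) : Lam * t + Lam * M * a_max * X = Lam * (t + M * (a_max * X)) by ring.
rewrite -mulr_sumr E; apply: ler_wpM2l; first exact: noise_ge0.
rewrite big_split /= addrC; apply: lerD.
  case: N {sm at0} => [|N]; first by rewrite big_ord0 mulr_ge0.
  by rewrite big_ord_recl /= big1 ?addr0.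
rewrite -!mulr_sumr; apply: ler_wpM2l => //; apply: ler_wpM2l => //.
by rewrite big_ord_recr /= lerDl at0.
Qed.

(* The initial z is bounded by B, the later ones by r. *)
Let mean_err_step k : (k < K)%N -> rmean (err k.+1) <=
  (1 - p) * (rmean (err k) + rmean (fun w => noise_k k / b%:R * move_sq k w)).
Proof.
move=> kK; rewrite (run_mean_resample bn bm hq _ kK) -run_meanD -run_meanZ.
apply: mean_le => w.
pose rho := if k == 0%N then B else r.
have -> : noise_k k = 18 * L ^+ 2 * (1 + rho ^+ 2).
  by rewrite /noise_k /rho; case: ifP.
have hrho : enorm (cur (run w k)).2 <= rho.
  rewrite /rho; case: eqVneq => [->|]; last by rewrite -lt0n; exact: z_in_ball.
  by rewrite /=; move: gap; rewrite /initial_gap; case: (cur st0) => -[x y] z [].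
have := direction_error_step b0 bn bm p1 hq L0 lF lG lhG (or_introl hrho).
apply: le_trans; rewrite le_eqVlt; apply/orP; left; apply/eqP.
by apply: eq_bigr => s _; rewrite /err run_resample step_prev step_dir.
Qed.

(** The two coupled estimates: the potential argument bounds the gains by the
    errors, and the variance reduction bounds the errors by the gains. *)
Lemma mean_gains_le :
  rmean (fun w => \sum_(k < K) alpha k * gains k w) <=
    2 * Psi + 2 * (gain * (c * ((1 + Lam0 + 8 * Lam) * B))).
Proof.
set U := rmean _; pose Q := a_max * \sum_(k < K) rmean (err k.+1).
have mean0 := @run_mean_ge0 R n m K b p qc bn bm hq.
have Q0 : 0 <= Q.
  by apply: mulr_ge0 => //; apply: sumr_ge0 => k _; exact: mean0.
have gains0 k w : 0 <= gains k w.
  by apply: le_trans (gains_ge k w); apply: mulr_ge0 => //; rewrite invr_ge0.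
have U0 : 0 <= U.
  apply: mean0 => w; apply: sumr_ge0 => k _; apply: mulr_ge0 => //.
  by apply: ltW; exact: alpha_gt0.
have Psi0 : 0 <= Psi by rewrite /Psi !addr_ge0 ?sqr_ge0.
have X0 : 0 <= c * ((1 + Lam0 + 8 * Lam) * B).
  apply: mulr_ge0; first exact: ltW.
  apply: mulr_ge0 => //; have := noise_ge0 L B; have := noise_ge0 L r.
  by rewrite -/Lam -/Lam0; lra.
apply: (@close_feedback _ U Q Psi _ gain (c ^+ 2 * (Lam * M))) => //.
- rewrite -/U; apply: le_trans (mean_le sum_gains) _.
  rewrite run_meanD mean_cst lerD2l !run_meanZ.
  by rewrite (run_mean_sum _ _ _ (fun k => err k.+1)).
have hS := sum_damped_errors (s := fun k => rmean (err k)) p0 p1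
  (fun k => mean0 _ (err_ge0 k)) mean_err_step.
rewrite /= in hS.
rewrite -(run_mean_sum _ _ _ (fun k w => noise_k k / b%:R * move_sq k w)) in hS.
have hW := mean_le sum_moves.
rewrite run_meanD mean_cst run_meanZ in hW.
have hT : rmean (fun w => \sum_(k < K) alpha k * total k w) <= 4 * U + Q.
  rewrite /Q -(run_mean_sum _ _ _ (fun k => err k.+1)) -!run_meanZ -run_meanD.
  apply: mean_le => w; rewrite !mulr_sumr -big_split; apply: ler_sum => k _ /=.
  apply: le_trans (ler_wpM2l (ltW (alpha_gt0 (ltn_ord k))) (totalE k w)) _.
  rewrite mulrDr mulrCA lerD2l; apply: ler_wpM2r => //; exact: alpha_le.
have E0 : rmean (err 0) = dir_sq f g (Defs.prev st0) (dir st0).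
  exact: (mean_cst (dir_sq f g (Defs.prev st0) (dir st0))).
rewrite E0 in hS.
apply: (error_budget _ _ (dir_sq_ge0 _ _ _ _) (psqnorm_ge0 _) (sqr_ge0 _)
  (noise_ge0 L B) (noise_ge0 L r) M0 a_max_ge0 _ _ _ init hS hW hT).
- by rewrite divr_ge0 ?subr_ge0 // ltW.
- by rewrite invr_ge0 ltW.
- by apply: addr_ge0 => //; apply: mulr_ge0.
- by rewrite divfK // gt_eqF.
- exact: rate_sqr.
Qed.

(** The lower bound on the step sizes removes the weights [alpha k]. *)
Lemma average_gradient_bound (theta : R) : (0 < K)%N -> 0 < theta ->
  (forall k, (k < K)%N -> theta * a_max <= alpha k) ->
  K%:R^-1 * \sum_(k < K) rmean (grads k) <=
  4 * (2 * Psi + 2 * (gain * (c * ((1 + Lam0 + 8 * Lam) * B)))) / (theta * c) *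
  (rate p b / K%:R).
Proof.
move=> K0 th0 ath; have := mean_gains_le; set C := _ + _ => hC.
have KR : 0 < K%:R :> R by rewrite ltr0n.
have h : theta * a_max / 4 * \sum_(k < K) rmean (grads k) <= C.
  apply: le_trans hC; rewrite -(run_mean_sum _ _ _ grads) -run_meanZ.
  apply: mean_le => w; rewrite mulr_sumr; apply: ler_sum => k _.
  apply: le_trans (_ : theta * a_max * (grads k w / 4) <= _).
    by rewrite [_ / 4 * _]mulrAC mulrA.
  apply: le_trans (ler_wpM2l (ltW (alpha_gt0 (ltn_ord k))) (gains_ge k w)).
  by apply: ler_wpM2r; [rewrite divr_ge0|exact: ath].
have -> : 4 * C / (theta * c) * (rate p b / K%:R) = K%:R^-1 * (C / (theta * a_max / 4)).
  by rewrite /a_max; field; rewrite !gt_eqF.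
apply: ler_wpM2l; first by rewrite invr_ge0 ltW.
have D0 : 0 < theta * a_max / 4 by rewrite divr_gt0 // mulr_gt0 // divr_gt0.
by rewrite ler_pdivlMr // mulrC.
Qed.

End Convergence.

(** The ratios [cb] and [cg]: the first summand makes the drift of the target
    harmless, the others let the contraction dominate the cross terms of the
    potential. *)
Lemma exists_step_ratios {R : realType} (mu q kappa nu : R) : 0 < mu ->
  exists cb cg : R,
  [/\ 0 < cb /\ 0 < cg,
      320 * q ^+ 2 * kappa ^+ 2 <= mu * cb,
      320 * q ^+ 2 * nu ^+ 2 <= mu * cg,
      8 * q ^+ 2 + 5 <= mu * cg &
      8 * q ^+ 2 + 5 + 32 * cg / mu * q ^+ 2 <= mu * cb].
Proof.
move=> mu0; have := mulr_ge0 (sqr_ge0 q) (sqr_ge0 nu).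
have := mulr_ge0 (sqr_ge0 q) (sqr_ge0 kappa); have := sqr_ge0 q.
move: (q ^+ 2) (kappa ^+ 2) (nu ^+ 2) => Q k n Q0 Qk Qn.
have cg0 : 0 < 320 * Q * n + (8 * Q + 5) by lra.
pose cg := (320 * Q * n + (8 * Q + 5)) / mu.
have cgp : 0 < cg by apply: divr_gt0.
have d3 : 0 <= 32 * cg / mu * Q.
  by apply: mulr_ge0 => //; apply: divr_ge0; [apply: mulr_ge0 => //|]; exact: ltW.
exists ((320 * Q * k + (8 * Q + 5 + 32 * cg / mu * Q)) / mu), cg.
have E x : mu * (x / mu) = x by rewrite mulrC divfK // gt_eqF.
rewrite !E; move: d3; set t := 32 * cg / mu * Q => d3; split; try lra.
split; last exact: cgp.
by apply: divr_gt0; [lra|exact: mu0].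
Qed.

Lemma exists_step_size {R : realType} (D1 D2 D3 D4 : R) :
  0 <= D1 -> 0 <= D2 -> 0 <= D3 -> 0 <= D4 ->
  exists c : R, [/\ 0 < c /\ c <= 1, c * D1 <= 1, c * D2 <= 1, c * D3 <= 1 & c * D4 <= 1].
Proof.
move=> h1 h2 h3 h4; pose D := 1 + D1 + D2 + D3 + D4.
have D0 : 0 < D by rewrite /D; lra.
exists D^-1; have cD x : x <= D -> D^-1 * x <= 1.
  by move=> xD; rewrite mulrC ler_pdivrMr // mul1r.
split; [split|..]; [by rewrite invr_gt0|rewrite -[D^-1]mulr1| | | |];
  by apply: cD; rewrite /D; lra.
Qed.

Theorem theorem3p7 (R : realType) (Lf L1g L2g mu Cf : R)
    (hLf : 0 <= Lf) (hL1g : 0 <= L1g) (hL2g : 0 <= L2g)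
    (hmu : 0 < mu) (hCf : 0 < Cf) :
  exists c cbeta cgamma : R,
    [/\ 0 < c, 0 < cbeta, 0 < cgamma &
    forall theta B : R, 0 < theta ->
    exists C : R, 0 < C /\
    forall (dx dy n m : nat)
      (F : 'I_n -> 'cV[R]_(dx + dy) -> R) (G : 'I_m -> 'cV[R]_(dx + dy) -> R),
    let f := mean F in
    let g := mean G in
    lipschitz_grad Lf f ->
    (forall x : 'cV[R]_dx,
       enorm (dsubmx (grad f (col_mx x (ystar g x)))) <= Cf) ->
    lipschitz_grad L1g g ->
    lipschitz_hess L2g g ->
    (forall x : 'cV[R]_dx, strongly_convex mu (fun y => g (col_mx x y))) ->
    (forall i, lipschitz_grad Lf (F i)) ->
    (forall j, lipschitz_grad L1g (G j)) ->
    (forall j, lipschitz_hess L2g (G j)) ->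
    forall (K b : nat) (p : R) (q : coins -> R)
      (alpha beta gamma : nat -> R) (st0 : @state R dx dy),
    (1 < K)%N -> (0 < b)%N -> (b <= n)%N -> (b <= m)%N ->
    0 < p <= 1 ->
    coin_law p q ->
    initial_gap f g st0 B ->
    initial_error f g (Cf / mu) st0 p b <= B * rate p b ->
    (forall k, (k < K)%N ->
       theta * (c / rate p b) <= alpha k <= c / rate p b) ->
    (forall k, (k < K)%N -> beta k = cbeta * alpha k) ->
    (forall k, (k < K)%N -> gamma k = cgamma * alpha k) ->
    K%:R^-1 * (\sum_(k < K)
      run_mean K b q (fun w =>
        enorm (grad (hyper f g)
          (xiter F G b (Cf / mu) alpha beta gamma st0 w k)) ^+ 2))
    <= C * (rate p b / K%:R)].
Proof.
pose L := 1 + Lf + L1g + L2g + mu; pose r := Cf / mu.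
have L1 : 1 <= L by rewrite /L; lra.
have r0 : 0 <= r by rewrite divr_ge0 // ltW.
have muL : mu <= L by rewrite /L; lra.
have LfL : Lf <= L by rewrite /L; lra.
have L1L : L1g <= L by rewrite /L; lra.
have L2L : L2g <= L by rewrite /L; lra.
have rE : mu * r = Cf by rewrite mulrC divfK // gt_eqF.
rewrite -/r -{}rE; move: L r L1 r0 muL LfL L1L L2L => L r L1 r0 muL LfL L1L L2L.
have q0 : 0 <= L * (1 + r) by apply: mulr_ge0; lra.
have [cb [cg [[cb0 cg0] cbd cgd cgb cbb]]] := exists_step_ratios (L * (1 + r))
  (L / mu) (L * (1 + r) * (1 + L / mu) / mu) hmu.
have gain0 : 0 <= error_gain mu cb cg.
  have := divr_ge0 (ltW cb0) (ltW hmu); have := divr_ge0 (ltW cg0) (ltW hmu).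
  by rewrite /error_gain -!mulrA; lra.
have E0 := mulr_ge0 (noise_ge0 L r) (speed_ge0 cb cg (L * (1 + r))).
set gain := error_gain mu cb cg in gain0 *.
set E := noise L r * _ in E0.
have [c [[c0 c1] hc1 hc2 hc3 hc4]] := exists_step_size
  (mulr_ge0 (mulr_ge0 (ler0n R 16) gain0) E0)
  (mulr_ge0 (ler0n R 2) (mulr_ge0 q0 (addr_ge0 ler01 (sqr_ge0 (L / mu)))))
  (divr_ge0 (mulr_ge0 (ltW cb0) (sqr_ge0 L)) (ltW hmu))
  (divr_ge0 (mulr_ge0 (ltW cg0) (sqr_ge0 L)) (ltW hmu)).
exists c, cb, cg; split=> // theta B th0.
pose Psi := B + B ^+ 2 + (B + r) ^+ 2.
pose C := 4 * (2 * Psi + 2 * (gain * (c * ((1 + noise L B + 8 * noise L r) * B)))) / (theta * c).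
exists (`|C| + 1); split; first by rewrite ltr_wpDl.
move=> dx dy n m F G f g lf bf lg lhg conv lF lG lhG K b p qc alpha beta gamma st0.
move=> K1 b0 bn bm /andP[p0 p1] hq gap init halpha hbeta hgamma.
have P : bilevel_problem L mu r f g.
  split=> //.
  - exact: lipschitz_gradW lf.
  - exact: lipschitz_gradW lg.
  - exact: lipschitz_hessW lhg.
have rate0 : 0 < rate p b by exact: lt_le_trans ltr01 (rate_ge1 p b).
have a0 k : (k < K)%N -> 0 < alpha k.
  by move=> /halpha /andP[h _]; apply: lt_le_trans h; rewrite mulr_gt0 // divr_gt0.
have ale k : (k < K)%N -> alpha k <= c / rate p b by move=> /halpha /andP[].
have age k : (k < K)%N -> theta * (c / rate p b) <= alpha k by move=> /halpha /andP[].
have lF' i := lipschitz_gradW LfL (lF i).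
have lG' j := lipschitz_gradW L1L (lG j).
have lhG' j := lipschitz_hessW L2L (lhG j).
have h1 : c * (L * (1 + r) * (1 + (L / mu) ^+ 2)) <= 1 / 2.
  by move: hc2; move: (L * (1 + r) * _) => u; lra.
have h2 : cb * c * L ^+ 2 <= mu.
  by move: hc3; rewrite mulrA ler_pdivrMr // mul1r mulrCA mulrA.
have h3 : cg * c * L ^+ 2 <= mu.
  by move: hc4; rewrite mulrA ler_pdivrMr // mul1r mulrCA mulrA.
have h4 : 16 * gain * (c ^+ 2 * E) <= 1.
  have : c * (c * (16 * gain * E)) <= 1 * 1.
    apply: ler_pM => //; first exact: ltW.
    by apply: mulr_ge0; [exact: ltW|apply: mulr_ge0 => //; apply: mulr_ge0].
  by rewrite (expr2 c); lra.
have main := average_gradient_bound P lF' lG' lhG' cb0 cg0 cbd cgd cgb cbb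
  b0 bn bm p0 p1 hq c0 h1 h2 h3 h4 gap init a0 ale hbeta hgamma (ltnW K1) th0 age.
have -> : \sum_(k < K) run_mean K b qc (fun w => enorm (grad (hyper f g)
    (xiter F G b r alpha beta gamma st0 w k)) ^+ 2) =
  \sum_(k < K) run_mean K b qc (fun w =>
    grad_sq f g (cur (run F G b r alpha beta gamma st0 w k))).
  by apply: eq_bigr => k _; apply: eq_run_mean => w; rewrite (grad_hyper P).
apply: le_trans main _; rewrite -/C; apply: ler_wpM2r.
  by rewrite divr_ge0 // ltW.
by apply: le_trans (ler_norm C) _; rewrite lerDl.
Qed.
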